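(* Let $S=(C,B,x,y)$ be topological recursion data with a local, possibly irregular, spectral curve with $N$ simple ramification points $p_1,\dots,p_N$, let $\alpha_a=1$ if $p_a$ is regular and $\alpha_a=0$ if $p_a$ is irregular, and let $Z_S$ be the partition function of its Chekhov--Eynard--Orantin topological recursion. Let $(R,T,\Delta)$ be the Givental data of $S$, so that $Z_S=\widehat R\widehat T\widehat\Delta\cdot\prod_{a=1}^N\tau_{\alpha_a}(\hbar,\mathbf T^a)$, and let $\widehat L^a_m$ be the Virasoro operators associated with $(R,T,\Delta)$ and $(\alpha_a)$ (all defined in the context). Then $$\widehat L^a_m\cdot Z_S=0\qquad\text{for all }a=1,\dots,N,\ m\ge-\alpha_a .$$
   Context: Topological recursion data. $C$ is a Riemann surface (possibly non-compact, possibly only an open subset of a Riemann surface: ''local''). $dx$ is a meromorphic differential on $C$ with finitely many zeros $p_1,\dots,p_N$, all simple. $y$ is a function meromorphic near each $p_a$; near $p_a$ choose a local coordinate $\zeta$ with $x=x(p_a)+\zeta^2/2$. A point $p_a$ is regular ($\alpha_a=1$) if $y=\sum_{k\ge0}y^a_k\zeta^k$ with $y_1^a\ne0$, and irregular ($\alpha_a=0$) if $y=\sum_{k\ge-1}y_k^a\zeta^k$ with $y^a_{-1}\neq0$; every $p_a$ is assumed to be of one of these two types. $B$ is a symmetric bidifferential on $C\times C$ with a double pole on the diagonal with double residue $1$ and no other poles near the $p_a$. $\sigma_a$ is the local involution near $p_a$ with $x\circ\sigma_a=x$. Correlators. $\omega_{0,1}=y\,dx$, $\omega_{0,2}=B$,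 and for $2g-2+n>0$, $n\ge1$, $$\omega_{g,n}(z_1,\dots,z_n)=\frac12\sum_{a=1}^N\mathop{\mathrm{Res}}_{z\to p_a}\frac{\int_{\sigma_a(z)}^zB(z_1,\cdot)}{\omega_{0,1}(z)-\omega_{0,1}(\sigma_a(z))}\Big(\omega_{g-1,n+1}(z,\sigma_a(z),z_2,\dots,z_n)+\sum\omega_{g_1,1+|I_1|}(z,z_{I_1})\,\omega_{g_2,1+|I_2|}(\sigma_a(z),z_{I_2})\Big),$$ the inner sum being over $g_1+g_2=g$, $I_1\sqcup I_2=\{2,\dots,n\}$ with $(g_1,|I_1|),(g_2,|I_2|)\ne(0,0)$. For $g\ge2$, $\omega_{g,0}=\frac1{2-2g}\sum_a\mathrm{Res}_{z\to p_a}\Phi\,\omega_{g,1}$ with $d\Phi=y\,dx$ locally. Let $\xi^a_0(q)=\mathrm{Res}_{p=p_a}\frac{B(p,q)}{\sqrt{2(x(p)-x(p_a))}}$, $\xi^a_k=-d(-\frac{\partial}{\partial x})^{k-1}\frac{\xi^a_0}{dx}$ for $k\ge1$. It is part of the setting that the stable $\omega_{g,n}$ are polynomials in the $\xi^a_k$. With formal variables $\mathbf T=\{T^a_k\}_{1\le a\le N,k\ge0}$, $\mathbf T^a=\{T_k^a\}_{k\ge0}$, $$Z_S=\exp\Big(\sum_{2g-2+n>0}\frac{\hbar^{2g-2+n}}{n!}\omega_{g,n}\big|_{\xi^a_k=T^a_k}\Big).$$ Virasoro operators in one family $\{T_k\}_{k\ge 0}$ ($T_k=\partial/\partial T_k=0$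 for $k<0$, $(-1)!!=1$): $$\widehat L_m=\tfrac12\sum_{i+j=-m-1}\frac{T_iT_j}{(2i-1)!!(2j-1)!!}+\sum_{k\ge0}\frac{(2k+2m+1)!!}{(2k-1)!!}T_k\frac{\partial}{\partial T_{k+m}}+\tfrac12\sum_{i+j=m-1}(2i+1)!!(2j+1)!!\frac{\partial^2}{\partial T_i\partial T_j};$$ $\widehat L_m(\mathbf T^a)$ is this operator in the variables $\mathbf T^a$. $\tau_1$ (Kontsevich--Witten) and $\tau_0$ (Brézin--Gross--Witten) are characterized as the unique $\tau_\alpha\in\mathbb C[\mathbf T][[\hbar]]$ with $\tau_\alpha|_{\mathbf T=0}=1$ and $\big(\tfrac12\widehat L_k-\frac{(2k+2\alpha+1)!!}{2\hbar}\frac{\partial}{\partial T_{k+\alpha}}+\frac{\delta_{k,0}}{16}\big)\tau_\alpha=0$ for all $k\ge-\alpha$. Givental data of $S$. By a theorem of Dunin-Barkowski--Orantin--Shadrin--Spitz and Chekhov--Norbury there are $R(z)=\exp(\sum_{k\ge1}r_kz^k)\in\mathrm{Id}+z\,\mathrm{End}(\mathbb C^N)[[z]]$, $T(z)=\sum_{j\ge1}\sum_a\Delta T^a_jz^j\tilde e_a$ with $\Delta T^a_1=0$ if $\alpha_a=1$ ($\tilde e_a$ the standard orthonormal basis of $\mathbb C^N$), and nonzero $\Delta_a=(y^a_{2\alpha_a-1})^{-2}$ with a choice of $\sqrt{\Delta_a}$, determined by $S$, such that $Z_S=\widehat R\widehat T\widehat\Delta\cdot\prod_a\tau_{\alpha_a}(\hbar,\mathbf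 T^a)$, where, with $r_k\tilde e_a=\sum_b(r_k)^b_a\tilde e_b$ and $(r_k)^{ab}=(r_k)_a^b$, $$\widehat R=\exp\Big(\sum_{k\ge1}\sum_{a,b}\Big(\sum_{j\ge0}(r_k)^b_aT^a_j\frac{\partial}{\partial T^b_{k+j}}+\tfrac12\sum_{j=0}^{k-1}(-1)^{j+1}(r_k)^{ab}\frac{\partial^2}{\partial T^a_j\partial T^b_{k-j-1}}\Big)\Big),$$ $\widehat T=\exp\big(\frac1\hbar\sum_{k\ge1,a}\Delta T^a_k\frac{\partial}{\partial T^a_k}\big)$, $\widehat\Delta\cdot\prod_a\tau_{\alpha_a}(\hbar,\mathbf T^a)=\prod_a\tau_{\alpha_a}(\hbar\sqrt{\Delta_a},\mathbf T^a)$. Associated Virasoro operators: $\widehat L^a_m=\widehat R\,\widehat\Lambda^a_m\,\widehat R^{-1}$ for $m\ge-\alpha_a$, with $$\widehat\Lambda^a_m=\tfrac12\widehat L_m(\mathbf T^a)-\frac{(2m+2\alpha_a+1)!!}{2\hbar\sqrt{\Delta_a}}\frac{\partial}{\partial T^a_{m+\alpha_a}}+\frac1{2\hbar}\sum_{k\ge1+\alpha_a}\frac{(2m+2k+1)!!}{(2k-1)!!}\Delta T^a_k\frac{\partial}{\partial T^a_{m+k}}+\frac{\delta_{m,0}}{16}.$$ *)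

(* Defs.v *)
(* The notations of [monalg] clash with those of MathComp-Analysis, hence the
   filtered import. *)
From HB Require Import structures.
From mathcomp Require Import all_boot all_order all_algebra finmap complex.
From mathcomp Require Import all_classical all_reals all_analysis.
From mathcomp.multinomials Require Import -(notations) monalg.

Set Implicit Arguments.
Unset Strict Implicit.
Unset Printing Implicit Defensive.

Import Order.TTheory GRing.Theory Num.Theory numFieldNormedType.Exports.

Local Open Scope classical_set_scope.
Local Open Scope ring_scope.

(* The regular copy [R[i]^o] carries the topology and the normed module
   structure over [R[i]]; hence [differentiable] means complex differentiable. *)
Notation Cplx R := (R[i]^o).

Section ComplexAnalysis.
Context {R : realType}.
Local Notation C := (Cplx R).

Definition holomorphic_at (f : C -> C) (z : C) : Prop :=
  \forall w \near z, differentiable f w.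

Definition holomorphic2_at (f : C -> C -> C) (z w : C) : Prop :=
  \forall q \near ((z, w) : C * C), differentiable (fun r : C * C => f r.1 r.2) q.

(* Functions are total: the value of a meromorphic function at a pole (or at a
   removable singularity) is arbitrary, and conditions are imposed on punctured
   neighbourhoods. *)
Definition meromorphic_at (f : C -> C) (z : C) : Prop :=
  exists (n : nat) (h : C -> C), holomorphic_at h z /\
    \forall w \near z^', f w = h w / (w - z) ^+ n.

Definition meromorphic2_at (f : C -> C -> C) (z w : C) : Prop :=
  exists g h : C -> C -> C,
    [/\ holomorphic2_at g z w, holomorphic2_at h z w,
        ~ (\forall q \near ((z, w) : C * C), h q.1 q.2 = 0) &
        \forall q \near ((z, w) : C * C),
          h q.1 q.2 != 0 -> f q.1 q.2 = g q.1 q.2 / h q.1 q.2].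

(* c is the coefficient of (w - z)^-1 in the Laurent expansion of f at z. *)
Definition is_residue (f : C -> C) (z c : C) : Prop :=
  exists (n : nat) (b : nat -> C) (h : C -> C),
    [/\ holomorphic_at h z, b 0%N = c &
        \forall w \near z^', f w = \sum_(k < n.+1) b k / (w - z) ^+ k.+1 + h w].

Definition residue (f : C -> C) (z : C) : C := xget 0 [set c | is_residue f z c].

(* The germ at z of a primitive of f(w) dw, unique up to a constant. *)
Definition is_primitive (f : C -> C) (z : C) (F : C -> C) : Prop :=
  \forall w \near z^', is_derive (w : C) (1 : C) F (f w).

Definition primitive (f : C -> C) (z : C) : C -> C :=
  xget (fun=> 0) [set F | is_primitive f z F].

End ComplexAnalysis.

(* Charts come with an inverse coordinate [icoord], meaningful on the image of
   the chart only. *)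
Record chart (R : realType) (X : topologicalType) := Chart {
  dom : set X;
  coord : X -> Cplx R;
  icoord : Cplx R -> X;
  dom_open : open dom;
  coord_open : open (coord @` dom);
  coordK : forall q, dom q -> icoord (coord q) = q;
  coord_continuous : forall q, dom q -> {for q, continuous coord};
  icoord_continuous : forall q, dom q -> {for coord q, continuous icoord}
}.

Definition compatible (R : realType) (X : topologicalType) (c d : chart R X) : Prop :=
  forall q, dom c q -> dom d q ->
    holomorphic_at (coord d \o icoord c) (coord c q) /\
    holomorphic_at (coord c \o icoord d) (coord d q).

(* Connectedness is not required: a local spectral curve may be a disjoint union
   of discs around the ramification points. *)
Record riemann_surface (R : realType) := RiemannSurface {
  rs_carrier :> topologicalType;
  rs_hausdorff : hausdorff_space rs_carrier;
  atlas : set (chart R rs_carrier);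
  atlas_cover : forall q, exists2 c, atlas c & dom c q;
  atlas_compatible : forall c d, atlas c -> atlas d -> compatible c d
}.

Section Differentials.
Context {R : realType} (X : riemann_surface R).
Local Notation C := (Cplx R).

Definition hol_chart (c : chart R X) : Prop := forall d, atlas d -> compatible c d.

(* A differential is encoded by its coefficients in all holomorphic charts: its
   value at [(c, z)] is the coefficient of dz at the point of coordinate z in the
   chart c.  Multidifferentials take several such arguments. *)
Definition cpt : Type := (chart R X * C)%type.

Definition jacobian (c d : chart R X) (z : C) : C := 'D_1 (coord d \o icoord c) z.

Definition is_differential (w : cpt -> C) : Prop :=
  forall c d q, hol_chart c -> hol_chart d -> dom c q -> dom d q ->
    w (c, coord c q) = w (d, coord d q) * jacobian c d (coord c q).

Definition meromorphic_differential (w : cpt -> C) : Prop :=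
  is_differential w /\
  forall c q, hol_chart c -> dom c q ->
    meromorphic_at (fun z => w (c, z)) (coord c q).

Definition is_zero (w : cpt -> C) (q : X) : Prop :=
  exists (c : chart R X) (h : C -> C),
    [/\ hol_chart c, dom c q, holomorphic_at h (coord c q), h (coord c q) = 0 &
        \forall z \near (coord c q)^', w (c, z) = h z].

Definition is_simple_zero (w : cpt -> C) (q : X) : Prop :=
  exists (c : chart R X) (h : C -> C),
    [/\ hol_chart c, dom c q, holomorphic_at h (coord c q), h (coord c q) != 0 &
        \forall z \near (coord c q)^', w (c, z) = (z - coord c q) * h z].

Definition meromorphic_bidifferential (B : cpt -> cpt -> C) : Prop :=
  [/\ forall P, is_differential (fun Q => B Q P),
      forall P, is_differential (fun Q => B P Q) &
      forall c d q r, hol_chart c -> hol_chart d -> dom c q -> dom d r ->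
        meromorphic2_at (fun z w => B (c, z) (d, w)) (coord c q) (coord d r)].

(* (u - v)^2 B(u, v) is meromorphic along the diagonal and restricts to 1 there;
   other polar divisors of B may still cross the diagonal. *)
Definition double_residue1 (B : cpt -> cpt -> C) : Prop :=
  forall c q, hol_chart c -> dom c q -> exists g h : C -> C -> C,
    [/\ holomorphic2_at g (coord c q) (coord c q),
        holomorphic2_at h (coord c q) (coord c q),
        ~ (\forall t \near coord c q, h t t = 0),
        \forall t \near coord c q, g t t = h t t &
        \forall r \near ((coord c q, coord c q) : C * C),
          r.1 != r.2 -> h r.1 r.2 != 0 ->
          (r.1 - r.2) ^+ 2 * B (c, r.1) (c, r.2) = g r.1 r.2 / h r.1 r.2].

End Differentials.

(* [tr_x] only matters near the ramification points, where it is a primitive of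
   [tr_dx]; away from them it may be multivalued.  [ycoef a k] is y^a_k, k >= -1. *)
Record tr_data (R : realType) (N : nat) := TRData {
  curve :> riemann_surface R;
  tr_dx : cpt curve -> Cplx R;
  tr_x : curve -> Cplx R;
  tr_y : curve -> Cplx R;
  tr_B : cpt curve -> cpt curve -> Cplx R;
  ram : 'I_N -> curve;
  zeta : 'I_N -> chart R curve;
  ycoef : 'I_N -> int -> R[i];
  regular : 'I_N -> bool;

  dx_meromorphic : meromorphic_differential tr_dx;
  ram_inj : injective ram;
  ramP : forall q, is_zero tr_dx q <-> exists a, q = ram a;
  ram_simple : forall a, is_simple_zero tr_dx (ram a);

  zeta_hol : forall a, hol_chart (zeta a);
  zeta_dom : forall a, dom (zeta a) (ram a);
  zeta_ram : forall a, coord (zeta a) (ram a) = 0;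
  zetaE : forall a q, dom (zeta a) q ->
    tr_x q = tr_x (ram a) + coord (zeta a) q ^+ 2 / 2%:R;
  x_dx : forall a, \forall s \near (0 : Cplx R)^',
    is_derive (s : Cplx R) (1 : Cplx R) (tr_x \o icoord (zeta a)) (tr_dx (zeta a, s));

  y_expansion : forall a, \forall s \near (0 : Cplx R)^',
    (fun n : nat => (ycoef a (-1) / s + \sum_(k < n) ycoef a k%:Z * s ^+ k : Cplx R))
      @ \oo --> tr_y (icoord (zeta a) s);
  y_type : forall a,
    if regular a then ycoef a (-1) = 0 /\ ycoef a 1 != 0 else ycoef a (-1) != 0;

  B_meromorphic : meromorphic_bidifferential tr_B;
  B_sym : forall P Q, tr_B P Q = tr_B Q P;
  B_diag : double_residue1 tr_B;
  B_ram : forall a b, exists h : Cplx R -> Cplx R -> Cplx R,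
    holomorphic2_at h 0 0 /\
    \forall r \near ((0, 0) : Cplx R * Cplx R),
      (a = b -> r.1 != r.2) ->
      tr_B (zeta a, r.1) (zeta b, r.2) = (a == b)%:R / (r.1 - r.2) ^+ 2 + h r.1 r.2
}.

Arguments tr_dx {R N} t _.
Arguments tr_x {R N} t _.
Arguments tr_y {R N} t _.
Arguments tr_B {R N} t _ _.
Arguments ram {R N} t _.
Arguments zeta {R N} t _.
Arguments ycoef {R N} t _ _.
Arguments regular {R N} t _.

Definition alpha (R : realType) (N : nat) (S : tr_data R N) (a : 'I_N) : nat :=
  nat_of_bool (regular S a).

Section TopologicalRecursion.
Context {R : realType} {N : nat} (S : tr_data R N).
Local Notation C := (Cplx R).

Definition omega01 (P : cpt S) : C := tr_y S (icoord P.1 P.2) * tr_dx S P.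

(* The involution sigma_a is s |-> - s in the coordinate zeta_a; this is the
   pullback of f(s) ds. *)
Definition sigma_pull (f : C -> C) (s : C) : C := - f (- s).

Definition tr_kernel (a : 'I_N) (P : cpt S) (s : C) : C :=
  let F := primitive (fun t => tr_B S P (zeta S a, t)) 0 in
  let w := fun t => omega01 (zeta S a, t) in
  (F s - F (- s)) / (w s - sigma_pull w s).

(* The subsets I_1 of {2, ..., n} are encoded by bit masks. *)
Definition tr_bracket (omega : nat -> seq (cpt S) -> C) (g : nat) (a : 'I_N)
    (zs : seq (cpt S)) (s : C) : C :=
  (if g is g'.+1 then
     sigma_pull (fun t => omega g' [:: (zeta S a, s), (zeta S a, t) & zs]) s
   else 0)
  + \sum_(g1 < g.+1) \sum_(m : (size zs).-tuple bool)
      let I1 := mask m zs in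
      let I2 := mask (map negb m) zs in
      if ((g1 == 0%N :> nat) && nilp I1) || (((g - g1)%N == 0%N) && nilp I2) then 0
      else omega g1 ((zeta S a, s) :: I1)
           * sigma_pull (fun t => omega (g - g1)%N ((zeta S a, t) :: I2)) s.

(* [omega g zs] is omega_{g,n}(zs) with n = size zs; the values omega_{0,0} and
   omega_{1,0} are not used. *)
Definition is_correlators (omega : nat -> seq (cpt S) -> C) : Prop :=
  [/\ forall P, omega 0%N [:: P] = omega01 P,
      forall P Q, omega 0%N [:: P; Q] = tr_B S P Q,
      forall g P zs, (2 < 2 * g + (size zs).+1)%N ->
        omega g (P :: zs) =
          2%:R^-1 * \sum_(a < N)
            residue (fun s => tr_kernel a P s * tr_bracket omega g a zs s) 0 &
      forall g, (2 <= g)%N ->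
        omega g [::] =
          (2%:R - (2 * g)%:R)^-1 * \sum_(a < N)
            residue (fun s => primitive (fun t => omega01 (zeta S a, t)) 0 s
                              * omega g [:: (zeta S a, s)]) 0].

(* sqrt(2 (x(p) - x(p_a))) is the coordinate zeta_a of p. *)
Definition xi0 (a : 'I_N) (P : cpt S) : C :=
  residue (fun s => tr_B S (zeta S a, s) P / s) 0.

Definition dcoord (f : cpt S -> C) (P : cpt S) : C := 'D_1 (fun z => f (P.1, z)) P.2.

Definition xi (a : 'I_N) (k : nat) (P : cpt S) : C :=
  if k is k'.+1 then
    - dcoord (iter k' (fun f Q => - (dcoord f Q / tr_dx S Q)) (fun Q => xi0 a Q / tr_dx S Q)) P
  else xi0 a P.

End TopologicalRecursion.

Section FormalVariables.
Context {R : realType} (I : choiceType).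

(* C[T_i, i in I], for a possibly infinite set of variables. *)
Definition Tpoly := malg (cmonom I) R[i].

Definition Tvar (i : I) : Tpoly := mkmalgU (ucm i) 1.

Definition Tderiv (i : I) (f : Tpoly) : Tpoly :=
  \sum_(m <- msupp f) mkmalgU (divcm m (ucm i)) (mcoeff m f *+ m i).

(* C[T][[hbar]], and two-sided Laurent series in hbar (the coefficient of hbar^d
   at index d) on which the operators act. *)
Definition hseries := nat -> Tpoly.
Definition hlaurent := int -> Tpoly.

Definition to_laurent (F : hseries) : hlaurent := fun d => if d is Posz n then F n else 0.

Definition hmul (F G : hseries) : hseries := fun d => \sum_(i < d.+1) F i * G (d - i)%N.
Definition hone : hseries := fun d => (d == 0%N)%:R.

(* For a series without constant term, F^n starts in degree n. *)
Definition hexp (F : hseries) : hseries :=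
  fun d => \sum_(n < d.+1) (n`!%:R^-1 : R[i]) *: iter n (hmul F) hone d.

Definition mulT (i : I) (F : hlaurent) : hlaurent := fun d => Tvar i * F d.
Definition dT (i : I) (F : hlaurent) : hlaurent := fun d => Tderiv i (F d).
Definition hinv (F : hlaurent) : hlaurent := fun d => F (d + 1).

(* Infinite sums are taken coefficientwise in hbar.  Where the operators below
   are applied, only finitely many terms of each coefficient are nonzero (the
   operators are locally nilpotent on polynomials, and the tau-functions are
   weighted homogeneous in each degree); a finitely supported sum [\sum_(j \in A)]
   with infinite support is 0 by convention. *)
Definition hsum (J : choiceType) (A : set J) (F : J -> hlaurent) : hlaurent :=
  fun d => \sum_(j \in A) F j d.

Definition op_exp (A : hlaurent -> hlaurent) (F : hlaurent) : hlaurent :=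
  fun d => \sum_(n \in [set: nat]) (n`!%:R^-1 : R[i]) *: iter n A F d.

(* n!! for odd n >= -1. *)
Definition dfact (n : int) : R[i] :=
  if n is Posz m then (\prod_(i < m.+1 | odd i) (i : nat))%:R else 1.

(* The family T_k, k >= 0, of variables is [v]. *)
Definition dTz (v : nat -> I) (k : int) (F : hlaurent) : hlaurent :=
  if k is Posz n then dT (v n) F else 0.

Definition virasoro (v : nat -> I) (m : int) (F : hlaurent) : hlaurent :=
  (2%:R^-1 : R[i]) *:
    (\sum_(i < `|m|.+1) \sum_(j < `|m|.+1 | i%:Z + j%:Z == - m - 1)
       (dfact (2 * i%:Z - 1) * dfact (2 * j%:Z - 1))^-1 *: mulT (v i) (mulT (v j) F))
  + hsum [set: nat] (fun k =>
      (dfact (2 * k%:Z + 2 * m + 1) / dfact (2 * k%:Z - 1))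
        *: mulT (v k) (dTz v (k%:Z + m) F))
  + (2%:R^-1 : R[i]) *:
    (\sum_(i < `|m|.+1) \sum_(j < `|m|.+1 | i%:Z + j%:Z == m - 1)
       (dfact (2 * i%:Z + 1) * dfact (2 * j%:Z + 1)) *: dT (v i) (dT (v j) F)).

End FormalVariables.

(* tau_1 (Kontsevich-Witten) for [al = true], tau_0 (Brezin-Gross-Witten) for
   [al = false]. *)
Definition is_tau (R : realType) (al : bool) (tau : @hseries R nat) : Prop :=
  (forall d, mcoeff (onecm nat) (tau d) = (d == 0%N)%:R) /\
  forall k : int, - (al : nat)%:Z <= k ->
    (2%:R^-1 : R[i]) *: virasoro id k (to_laurent tau)
    - (@dfact R (2 * k + 2 * (al : nat)%:Z + 1) / 2%:R)
        *: hinv (dTz id (k + (al : nat)%:Z) (to_laurent tau))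
    + ((k == 0)%:R / 16%:R : R[i]) *: to_laurent tau = 0.

Section PartitionFunction.
Context {R : realType} {N : nat} (S : tr_data R N).
Local Notation C := (Cplx R).
Local Notation idx := ('I_N * nat)%type.

(* W is the polynomial obtained from the expansion of w in the xi^a_k near the
   ramification points by the substitution xi^a_k = T^a_k. *)
Definition xi_substitution (n : nat) (w : seq (cpt S) -> C) (W : @Tpoly R idx) : Prop :=
  exists c : seq (R[i] * n.-tuple idx),
    (exists2 e : R[i], 0 < e &
       forall (b : 'I_n -> 'I_N) (s : 'I_n -> C), (forall i, 0 < `|s i| < e) ->
         w [seq (zeta S (b i), s i) | i <- enum 'I_n] =
         \sum_(t <- c) t.1 * \prod_(i < n)
           xi (tnth t.2 i).1 (tnth t.2 i).2 (zeta S (b i), s i)) /\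
    W = \sum_(t <- c) t.1 *: \prod_(i < n) Tvar (tnth t.2 i).

(* The coefficient of hbar^d collects the (g, n) with 2g - 2 + n = d > 0. *)
Definition free_energy (W : nat -> nat -> @Tpoly R idx) : @hseries R idx :=
  fun d => if d is 0%N then 0 else
    \sum_(g < d.+3 | (2 * g <= d + 2)%N)
      ((d + 2 - 2 * g)`!%:R^-1 : R[i]) *: W g (d + 2 - 2 * g)%N.

Definition is_partition_function (Z : @hseries R idx) : Prop :=
  exists (omega : nat -> seq (cpt S) -> C) (W : nat -> nat -> @Tpoly R idx),
    [/\ is_correlators omega,
        forall g n, (2 < 2 * g + n)%N -> xi_substitution n (omega g) (W g n) &
        Z = hexp (free_energy W)].

End PartitionFunction.

(* R(z) = exp(\sum_(k >= 1) r_k z^k) is given by the matrices [gr k] = r_k, with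
   r_k e_a = \sum_b (r_k)^b_a e_b, i.e. (r_k)^b_a = [gr k b a]; and
   T(z) = \sum_(k >= 1) \sum_a [gT a k] z^k e_a.  Index 0 is not used. *)
Record givental_data (R : realType) (N : nat) := GiventalData {
  gr : nat -> 'M[R[i]]_N;
  gT : 'I_N -> nat -> R[i];
  gDelta : 'I_N -> R[i];
  gsqrtDelta : 'I_N -> R[i]
}.

Section Givental.
Context {R : realType} {N : nat} (G : givental_data R N).
Local Notation idx := ('I_N * nat)%type.
Local Notation laurent := (@hlaurent R idx).

(* The polynomial f in the variables T^a. *)
Definition in_family (a : 'I_N) (f : @Tpoly R nat) : @Tpoly R idx :=
  \sum_(m <- msupp f) mcoeff m f *: \prod_(k <- finsupp m) Tvar (a, k) ^+ m k.

Definition Rgen (F : laurent) : laurent :=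
  hsum [set k : nat | (1 <= k)%N] (fun k =>
    \sum_(a < N) \sum_(b < N)
      (hsum [set: nat] (fun j => gr G k b a *: mulT (a, j) (dT (b, (k + j)%N) F))
       + (2%:R^-1 : R[i]) *: \sum_(j < k)
           ((-1) ^+ j.+1 * gr G k b a) *: dT (a, j : nat) (dT (b, (k - j - 1)%N) F))).

Definition Rhat : laurent -> laurent := op_exp Rgen.
(* exp(- A) is the inverse of exp(A), A being locally nilpotent. *)
Definition Rhat_inv : laurent -> laurent := op_exp (fun F => - Rgen F).

Definition That : laurent -> laurent :=
  op_exp (fun F => hinv (hsum [set k : nat | (1 <= k)%N] (fun k =>
    \sum_(a < N) gT G a k *: dT (a, k) F))).

Definition Delta_hat (al : 'I_N -> bool) (tau : bool -> @hseries R nat) : @hseries R idx :=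
  \big[@hmul R idx/@hone R idx]_(a < N)
    (fun d => gsqrtDelta G a ^+ d *: in_family a (tau (al a) d)).

Definition Lambda_hat (al : 'I_N -> bool) (a : 'I_N) (m : int) (F : laurent) : laurent :=
  let v := fun k : nat => (a, k) in
  let al_a := (al a : nat) in
  (2%:R^-1 : R[i]) *: virasoro v m F
  - (dfact (2 * m + 2 * al_a%:Z + 1) / (2%:R * gsqrtDelta G a))
      *: hinv (dTz v (m + al_a%:Z) F)
  + (2%:R^-1 : R[i]) *: hinv (hsum [set k : nat | (1 + al_a <= k)%N] (fun k =>
      (dfact (2 * m + 2 * k%:Z + 1) / dfact (2 * k%:Z - 1) * gT G a k)
        *: dTz v (m + k%:Z) F))
  + ((m == 0)%:R / 16%:R : R[i]) *: F.

Definition L_hat (al : 'I_N -> bool) (a : 'I_N) (m : int) (F : laurent) : laurent :=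
  Rhat (Lambda_hat al a m (Rhat_inv F)).

End Givental.

Definition is_givental_data (R : realType) (N : nat) (S : tr_data R N)
    (tau : bool -> @hseries R nat) (Z : @hseries R ('I_N * nat)%type)
    (G : givental_data R N) : Prop :=
  [/\ forall a, regular S a -> gT G a 1 = 0,
      forall a, gDelta G a = (ycoef S a (2 * (alpha S a)%:Z - 1)) ^- 2,
      forall a, gsqrtDelta G a ^+ 2 = gDelta G a &
      to_laurent Z = Rhat G (That G (to_laurent (Delta_hat G (regular S) tau)))].

(* Main.v *)
(* Conjugating by exp of a translation D turns the undeformed operators (half a
   Virasoro operator plus a 1/hbar dilaton term plus a constant) into the
   operators Lambda, because [D, L_m] is a constant coefficient derivation, which
   commutes with D.  The undeformed operators of family a annihilate the product
   of tau-functions, since the other factors do not involve T^a.  Conjugating by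
   exp of the generator r of R gives the theorem.

   The point needing care is that all exponentials are locally finite.  For r,
   giving T_j the weight j + 1 makes r strictly weight decreasing.  For D, the
   Virasoro equations express the derivatives of the hbar^(d+1) coefficient of
   tau_alpha through its hbar^d coefficient; by induction on d, every monomial of
   the latter has weight at most (2 alpha + 1) d, where T_k has weight 2 k + 1.
   Normalised so that hbar has weight 3, D / hbar then lowers the weight excess
   over 3 d by 2. *)
Require Import Defs.
From HB Require Import structures.
From mathcomp Require Import all_boot all_order all_algebra finmap complex.
From mathcomp Require Import all_classical all_reals all_analysis.
From mathcomp.multinomials Require Import -(notations) monalg.
From mathcomp Require Import zify ring.

Set Implicit Arguments.
Unset Strict Implicit.
Unset Printing Implicit Defensive.

Import Order.TTheory GRing.Theory Num.Theory.

Local Open Scope ring_scope.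

(** * Derivations and weights *)

(* Scaling, too, is a sum over the support; the lock keeps unification from
   comparing the two sums. *)
HB.lock Definition pder (R : realType) (I : choiceType) (i : I) (f : @Tpoly R I) :
  @Tpoly R I := Tderiv i f.

Section Derivatives.
Context {R : realType} {I : choiceType}.
Implicit Types (f g : @Tpoly R I) (m : cmonom I) (i j : I).

Lemma Tderiv_bigE (d : {fset cmonom I}) i f : (msupp f `<=` d)%fset ->
  Tderiv i f = \sum_(m <- d) mkmalgU (divcm m (ucm i)) (mcoeff m f *+ m i).
Proof.
move=> le; rewrite /Tderiv (big_fset_incl _ le) //= => m _ /mcoeff_outdom ->.
by rewrite mul0rn monalgU0.
Qed.

(** Coefficients determine a polynomial, so linearity and commutation of the derivations reduce to
    this formula. *)
Lemma mcoeff_pder i f m :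
  mcoeff m (pder i f) = mcoeff (mulcm (ucm i) m) f *+ (m i).+1.
Proof.
pose n := mulcm (ucm i) m.
rewrite pder.unlock (@Tderiv_bigE (n |` msupp f)%fset) ?fsubsetUr // raddf_sum /=.
rewrite (big_fsetD1 n) ?in_fset1U ?eqxx //= big1_fset ?addr0.
  have -> : divcm n (ucm i) = m.
    by apply/eqP/cmP => j; rewrite divcmE mulcmE addKn.
  by rewrite mcoeffUU /n mulcmE ucmE eqxx.
move=> m'; rewrite in_fsetD1 => /andP[ne _] _; rewrite mcoeffU.
(* Division of monomials is truncated, so an [m'] free of [i] can also divide to [m]; its term
   vanishes through the factor [m' i = 0]. *)
case: eqP => // e; case: (posnP (m' i)) => [->//|m'i].
case/eqP: ne; apply/eqP/cmP => j; move/eqP/cmP/(_ j): e.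
rewrite mulcmE divcmE ucmE; case: eqP => [<-|_]; lia.
Qed.

Lemma pder_is_linear i : linear (@pder R I i).
Proof.
move=> c f g; apply/malgP => m.
by rewrite mcoeff_pder !mcoeffD !mcoeffZ !mcoeff_pder mulrnDl mulrnAr.
Qed.

HB.instance Definition _ i :=
  GRing.isLinear.Build R[i] (@Tpoly R I) (@Tpoly R I) *:%R (pder i)
    (pder_is_linear i).

Lemma pderU i (c : R[i]) m :
  pder i (mkmalgU m c) = mkmalgU (divcm m (ucm i)) (c *+ m i).
Proof. by rewrite pder.unlock (Tderiv_bigE _ (msuppU_le)) big_seq_fset1 mcoeffUU. Qed.

Lemma pderC i j f : pder i (pder j f) = pder j (pder i f).
Proof.
apply/malgP => m; rewrite !mcoeff_pder !mulcmE !ucmE.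
have [->//|ne] := eqVneq i j.
rewrite !add0n mulrnAC; congr (mcoeff _ _ *+ _ *+ _).
by rewrite !mulcmA [mulcm (ucm j) _]mulcmC.
Qed.

Lemma malgMUU m n (c e : R[i]) :
  mkmalgU m c * mkmalgU n e = mkmalgU (mulcm m n) (c * e).
Proof. exact: fgmulUU. Qed.

Lemma pderM i f g : pder i (f * g) = pder i f * g + f * pder i g.
Proof.
(* Both sides are bilinear, so monomials suffice. When [i] does not occur in a factor, truncated
   division gives the wrong monomial, but its coefficient is 0. *)
have UM m n (c e : R[i]) : pder i (mkmalgU m c * mkmalgU n e) =
    pder i (mkmalgU m c) * mkmalgU n e + mkmalgU m c * pder i (mkmalgU n e).
  transitivity (mkmalgU (divcm (mulcm m n) (ucm i)) (c * e *+ m i)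
    + mkmalgU (divcm (mulcm m n) (ucm i)) (c * e *+ n i)).
    by rewrite [X in pder i X]malgMUU [LHS]pderU mulcmE mulrnDr [LHS]monalgUD.
  congr (_ + _).
  - rewrite [in RHS]pderU [RHS]malgMUU mulrnAl.
    case: (posnP (m i)) => [->|mi]; first by rewrite !mulr0n [LHS]monalgU0 [RHS]monalgU0.
    suff -> : divcm (mulcm m n) (ucm i) = mulcm (divcm m (ucm i)) n by [].
    apply/eqP/cmP => j; rewrite !(mulcmE, divcmE) ucmE.
    by case: eqP => [<-|_]; lia.
  - rewrite [in RHS]pderU [RHS]malgMUU mulrnAr.
    case: (posnP (n i)) => [->|ni]; first by rewrite !mulr0n [LHS]monalgU0 [RHS]monalgU0.
    suff -> : divcm (mulcm m n) (ucm i) = mulcm m (divcm n (ucm i)) by [].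
    apply/eqP/cmP => j; rewrite !(mulcmE, divcmE) ucmE.
    by case: eqP => [<-|_]; lia.
rewrite [f]monalgE mulr_suml !raddf_sum mulr_suml mulr_suml -big_split /=.
apply: eq_bigr => m _.
rewrite [g]monalgE mulr_sumr !raddf_sum /= !mulr_sumr -big_split /=.
by apply: eq_bigr => n _; rewrite UM.
Qed.

Lemma pder_Tvar i j : pder i (Tvar j) = (i == j)%:R :> @Tpoly R I.
Proof.
rewrite /Tvar pderU ucmE eq_sym; case: eqP => [->|_]; last by rewrite monalgU0.
have -> : divcm (ucm j) (ucm j) = onecm I.
  by apply/eqP/cmP => k; rewrite divcmE subnn onecmE.
by rewrite mulr1n -mpolyC1E.
Qed.

End Derivatives.

Section Weights.
Context {R : realType} {I : choiceType} (w : I -> nat).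
Implicit Types (f g : @Tpoly R I) (m : cmonom I) (i j : I).

Definition wt m : nat := (\sum_(i <- finsupp m) w i * m i)%N.

Lemma wtEw (d : {fset I}) m : (finsupp m `<=` d)%fset ->
  wt m = (\sum_(i <- d) w i * m i)%N.
Proof.
move=> le; rewrite /wt (big_fset_incl _ le) // => i _.
by move=> /fsfun_dflt ->; rewrite muln0.
Qed.

Lemma wtM m n : wt (mulcm m n) = (wt m + wt n)%N.
Proof.
have le : (finsupp (mulcm m n) `<=` finsupp m `|` finsupp n)%fset.
  apply/fsubsetP => i; rewrite in_fsetU !mem_finsupp mulcmE; lia.
rewrite (wtEw le) (wtEw (fsubsetUl _ (finsupp n))).
rewrite (wtEw (fsubsetUr (finsupp m) _)) -big_split /=.
by apply: eq_bigr => i _; rewrite mulcmE mulnDr.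
Qed.

Lemma wtU i : wt (ucm i) = w i.
Proof.
have le : (finsupp (ucm i) `<=` [fset i])%fset.
  by apply/fsubsetP => j; rewrite mem_finsupp ucmE in_fset1; case: (eqVneq i j).
by rewrite (wtEw le) big_seq_fset1 ucmE eqxx muln1.
Qed.

Lemma wt1 : wt (onecm I) = 0%N.
Proof. by rewrite /wt big1_fset // => i _ _; rewrite onecmE muln0. Qed.

(** The bound is an integer so that repeated lowering can push it below 0, where only the zero
    polynomial remains ([wle_lt0]). All local finiteness is obtained this way. *)
Definition wle (c : int) f : bool := all (fun m => (wt m)%:Z <= c) (msupp f).

Lemma wleP {c f} : reflect (forall m, m \in msupp f -> (wt m)%:Z <= c) (wle c f).
Proof. exact: allP. Qed.

Lemma wle_mono c e f : c <= e -> wle c f -> wle e f.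
Proof. by move=> le /wleP H; apply/wleP => m /H /le_trans; apply. Qed.

Lemma wle_ex f : exists c : nat, wle c%:Z f.
Proof.
exists (\sum_(m <- msupp f) wt m)%N; apply/wleP => m mf.
by rewrite (big_fsetD1 m) //= lez_nat leq_addr.
Qed.

Lemma wle_lt0 c f : c < 0 -> wle c f -> f = 0.
Proof.
move=> c0 /wleP H; apply/malgP => m; rewrite mcoeff0; apply/eqP.
rewrite mcoeff_eq0; apply/negP => /H; lia.
Qed.

Lemma wle0 c : wle c (0 : @Tpoly R I).
Proof. by apply/wleP => m; rewrite msupp0 in_fset0. Qed.

Lemma wle1 : wle 0 (1 : @Tpoly R I).
Proof.
by apply/wleP => m /(fsubsetP msuppU_le); rewrite in_fset1 => /eqP ->; rewrite wt1.
Qed.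

Lemma wleD c f g : wle c f -> wle c g -> wle c (f + g).
Proof.
move=> /wleP Hf /wleP Hg; apply/wleP => m /(fsubsetP (msuppD_le _ _)).
by rewrite in_fsetU; case/orP => [/Hf|/Hg].
Qed.

Lemma wleZ c (a : R[i]) f : wle c f -> wle c (a *: f).
Proof. by move=> /wleP Hf; apply/wleP => m /(fsubsetP (msuppZ_le _ _)) /Hf. Qed.

Lemma wle_sum (J : Type) (r : seq J) (P : pred J) (F : J -> @Tpoly R I) c :
  (forall k, P k -> wle c (F k)) -> wle c (\sum_(k <- r | P k) F k).
Proof. by apply: (big_ind (fun f => wle c f)); [exact: wle0|exact: wleD]. Qed.

Lemma wle_fsum (J : choiceType) (A : set J) (F : J -> @Tpoly R I) c :
  (forall k, A k -> wle c (F k)) -> wle c (\sum_(k \in A) F k).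
Proof.
(* A sum with infinite support is 0 by convention and satisfies every bound. *)
move=> H; case: finite_supportP => [_|X XA _ _]; first by rewrite big_nil wle0.
by rewrite big_seq; apply: wle_sum => k kX; apply: H; apply: XA.
Qed.

Lemma wleM c e f g : wle c f -> wle e g -> wle (c + e) (f * g).
Proof.
move=> /wleP Hf /wleP Hg; apply/wleP => m /msuppM_le [m1 [m2 [/Hf h1 /Hg h2 ->]]].
by rewrite [mul _ _]/(mulcm _ _) wtM PoszD lerD.
Qed.

Lemma wle_Tvar i : wle (w i)%:Z (Tvar i : @Tpoly R I).
Proof. by apply/wleP => m; rewrite msuppU1 in_fset1 => /eqP ->; rewrite wtU. Qed.

Lemma wle_TvarM c i f : wle c f -> wle (c + (w i)%:Z) (Tvar i * f).
Proof. by rewrite addrC; apply: wleM; apply: wle_Tvar. Qed.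

Lemma wle_pder c i f : wle c f -> wle (c - (w i)%:Z) (pder i f).
Proof.
move=> /wleP H; apply/wleP => m; rewrite -mcoeff_neq0 mcoeff_pder => ne.
have /H : mulcm (ucm i) m \in msupp f.
  by rewrite -mcoeff_neq0; apply: contraNneq ne => ->; rewrite mul0rn.
rewrite wtM wtU; lia.
Qed.

(** A nonconstant monomial of [f] is visible in the derivative along any of its variables, because
    the characteristic is 0. Constants have weight 0, whence [0 <= c]. *)
Lemma pder_wle c f : 0 <= c ->
  (forall i, wle (c - (w i)%:Z) (pder i f)) -> wle c f.
Proof.
move=> c0 H; apply/wleP => m mf.
case: (pselect (exists i, (0 < m i)%N)) => [[i mi]|no]; last first.
  suff -> : m = onecm I by rewrite wt1.
  apply/eqP/cmP => i; rewrite onecmE; case: (posnP (m i)) => // mi.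
  by case: no; exists i.
pose n := divcm m (ucm i).
have e : m = mulcm (ucm i) n.
  apply/eqP/cmP => j; rewrite mulcmE divcmE ucmE.
  by case: eqP => [<-|]; lia.
have : n \in msupp (pder i f).
  by rewrite -mcoeff_neq0 mcoeff_pder -e mulrn_eq0 //= mcoeff_neq0.
move/(wleP (H i)); rewrite e wtM wtU; lia.
Qed.

Lemma wle_pder0 c i f : c < (w i)%:Z -> wle c f -> pder i f = 0.
Proof. by move=> lt /(wle_pder i); apply: wle_lt0; rewrite subr_lt0. Qed.

End Weights.

(** * Locally finite sums and exponentials *)

Section EventuallyZero.
Context {V : zmodType}.
Implicit Types (g h : nat -> V) (A : set nat).

Definition evz g := exists M : nat, forall k, (M <= k)%N -> g k = 0.

Lemma fsum_trunc A g (M : nat) : (forall k, (M <= k)%N -> g k = 0) ->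
  \sum_(k \in A) g k = \sum_(k < M | (k : nat) \in A) g k.
Proof.
move=> H; rewrite -(big_mkord (fun k => k \in A)).
rewrite (fsbigE [seq k <- index_iota 0 M | k \in A]).
- by rewrite big_filter_cond; apply: eq_bigl => k; rewrite andbb.
- exact/filter_uniq/iota_uniq.
- by move=> k /=; rewrite mem_filter => /andP[/set_mem].
- move=> k Ak; rewrite mem_filter mem_index_iota mem_set //= => kM.
  by apply: H; rewrite leqNgt.
Qed.

Lemma fsumD A g h : evz g -> evz h ->
  \sum_(k \in A) (g k + h k) = \sum_(k \in A) g k + \sum_(k \in A) h k.
Proof.
move=> [M HM] [P HP].
rewrite !(@fsum_trunc _ _ (M + P)%N) ?big_split //= => k le;
  by rewrite ?HM ?HP ?addr0 //; lia.
Qed.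

End EventuallyZero.

Lemma fsum_morph (V W : zmodType) (phi : V -> W) (A : set nat) (g : nat -> V) :
  {morph phi : f h / f + h} -> phi 0 = 0 -> evz g ->
  phi (\sum_(k \in A) g k) = \sum_(k \in A) phi (g k).
Proof.
move=> phiD phi0 [M HM].
rewrite (fsum_trunc _ HM) (big_morph phi phiD phi0); apply/esym/fsum_trunc => k le.
by rewrite HM.
Qed.

(** Terms are regrouped along the antidiagonals [l = j + i], as in a Cauchy product; those beyond
    the triangle vanish. *)
Lemma sum_triangle (V : nmodType) (n : nat) (G : nat -> nat -> V) :
  (forall j i, (n <= j + i)%N -> G j i = 0) ->
  \sum_(j < n) \sum_(i < n) G j i = \sum_(l < n) \sum_(j < l.+1) G j (l - j)%N.
Proof.
move=> G0.
transitivity (\sum_(j < n) \sum_(l < n | (j <= l)%N) G j (l - j)%N).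
  apply: eq_bigr => j _.
  transitivity (\sum_(j <= l < n) G j (l - j)%N); last by rewrite big_geq_mkord.
  rewrite -(big_mkord xpredT (G j)) (@big_cat_nat _ _ _ (n - j)%N) ?leq_subr //=.
  rewrite [X in _ + X]big_nat_cond [X in _ + X]big1 ?addr0 => [|i]; last first.
    by case/andP => /andP[le _] _; apply: G0; lia.
  transitivity (\sum_(0 + j <= l < n) G j (l - j)%N) => //; rewrite big_addn.
  by apply: eq_bigr => i _; rewrite addnK.
rewrite (exchange_big_dep xpredT) //=; apply: eq_bigr => l _.
rewrite -(big_mkord xpredT (fun j => G j (l - j)%N)) (big_nat_widen _ _ n) //.
by rewrite big_mkord.
Qed.

Section Exponential.
Context {K : numFieldType} {V : lmodType K} (r : {linear V -> V}).

Lemma iter_raddfD n f g : iter n r (f + g) = iter n r f + iter n r g.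
Proof. by elim: n => //= n ->; rewrite raddfD. Qed.

Lemma iter_raddf0 n : iter n r 0 = 0.
Proof. by elim: n => //= n ->; rewrite raddf0. Qed.

Lemma iter_linearZ n a f : iter n r (a *: f) = a *: iter n r f.
Proof. by elim: n => //= n ->; rewrite linearZ. Qed.

Lemma iter_raddf_sum n (J : Type) (s : seq J) (P : pred J) (F : J -> V) :
  iter n r (\sum_(j <- s | P j) F j) = \sum_(j <- s | P j) iter n r (F j).
Proof. exact: (big_morph _ (iter_raddfD n) (iter_raddf0 n)). Qed.

Lemma iter_oppr n f : iter n (fun g => - r g) f = (-1) ^+ n *: iter n r f.
Proof.
elim: n => [|n IH]; first by rewrite expr0 scale1r.
by rewrite !iterS IH linearZ exprS mulN1r scaleNr.
Qed.

Lemma iter_eq0 n k f : (n <= k)%N -> iter n r f = 0 -> iter k r f = 0.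
Proof. by move=> /subnK <- e; rewrite iterD e iter_raddf0. Qed.

Definition exp_op (f : V) : V := \sum_(n \in [set: nat]) (n`!%:R^-1 : K) *: iter n r f.

Lemma fact_neq0 n : n`!%:R != 0 :> K.
Proof. by rewrite pnatr_eq0 -lt0n fact_gt0. Qed.

(** This is the binomial expansion of [(1 - 1) ^+ n], divided by [n!]. *)
Lemma exp_coef_inv (n : nat) :
  \sum_(i < n.+1) ((-1) ^+ i / i`!%:R / (n - i)`!%:R) = (n == 0%N)%:R :> K.
Proof.
transitivity (n`!%:R^-1 * (1 - 1) ^+ n : K).
  rewrite exprBn mulr_sumr; apply: eq_bigr => i _.
  have le : (i <= n)%N by rewrite -ltnS.
  rewrite !expr1n !mulr1 -(bin_fact le) !natrM -mulr_natr.
  have b0 : 'C(n, i)%:R != 0 :> K by rewrite pnatr_eq0 -lt0n bin_gt0.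
  by field; rewrite !fact_neq0 b0.
rewrite subrr expr0n; case: n => [|n] /=; last by rewrite mulr0.
by rewrite fact0 mulr1 invr1.
Qed.

(** Nilpotency on [f] makes both exponentials finite sums; their Cauchy product has coefficients
    [exp_coef_inv], so only the term of order 0 survives. *)
Lemma exp_inv n f : iter n r f = 0 ->
  \sum_(j \in [set: nat]) (j`!%:R^-1 : K) *: iter j (fun g => - r g) (exp_op f) = f.
Proof.
move=> nil.
have expE : exp_op f = \sum_(i < n) (i`!%:R^-1 : K) *: iter i r f.
  rewrite /exp_op (@fsum_trunc _ _ _ n) => [|k le].
    by apply: eq_bigl => i; rewrite in_setT.
  by rewrite (iter_eq0 le nil) scaler0.
pose G (j i : nat) : V := ((-1) ^+ j / j`!%:R / i`!%:R) *: iter (j + i) r f.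
have itE j : (j`!%:R^-1 : K) *: iter j (fun g => - r g) (exp_op f) = \sum_(i < n) G j i.
  rewrite iter_oppr expE iter_raddf_sum !scaler_sumr; apply: eq_bigr => i _.
  by rewrite iter_linearZ !scalerA /G iterD; congr (_ *: _); ring.
have G0 j i : (n <= j + i)%N -> G j i = 0.
  by move=> le; rewrite /G (iter_eq0 le nil) scaler0.
rewrite (@fsum_trunc _ _ _ n) => [|k le]; last first.
  by rewrite itE big1 // => i _; rewrite G0 //; lia.
transitivity (\sum_(j < n) \sum_(i < n) G j i).
  by apply: eq_big => [j|j _]; rewrite ?in_setT.
rewrite sum_triangle //.
transitivity (\sum_(l < n) (l == 0%N :> nat)%:R *: iter l r f : V).
  apply: eq_bigr => l _; rewrite -exp_coef_inv scaler_suml.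
  by apply: eq_bigr => j _; rewrite /G subnKC // -ltnS.
case: n nil {expE itE G0} => [/= ->|n _]; first by rewrite big_ord0.
by rewrite big_ord_recl /= scale1r big1 ?addr0 // => i _; rewrite scale0r.
Qed.

End Exponential.

(** * Virasoro operators over an abstract algebra *)

Section LinearMaps.
Context {K : pzRingType} {V W : lmodType K} (phi : V -> W).
Hypothesis phi_lin : linear phi.

(** These rules take a bare proof of [linear], so that operators given as infinite sums need not be
    packed as structures. *)
Lemma linD : {morph phi : f g / f + g}.
Proof. by move=> f g; rewrite -[f]scale1r phi_lin !scale1r. Qed.

Lemma lin0 : phi 0 = 0.
Proof. by apply: (addrI (phi 0)); rewrite -linD !addr0. Qed.

Lemma linZ a f : phi (a *: f) = a *: phi f.
Proof. by rewrite -[a *: f]addr0 phi_lin lin0 addr0. Qed.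

Lemma linB : {morph phi : f g / f - g}.
Proof. by move=> f g; rewrite linD -(scaleN1r g) linZ scaleN1r. Qed.

Lemma lin_sum (J : Type) (s : seq J) (P : pred J) (F : J -> V) :
  phi (\sum_(j <- s | P j) F j) = \sum_(j <- s | P j) phi (F j).
Proof. exact: (big_morph phi linD lin0). Qed.

End LinearMaps.

Lemma fsum_linear (K : pzRingType) (V W : lmodType K) (A : set nat)
    (L : nat -> V -> W) :
  (forall k, linear (L k)) -> (forall f, evz (fun k => L k f)) ->
  linear (fun f => \sum_(k \in A) L k f).
Proof.
move=> Llin Levz a f g; have [M HM] := Levz f; have [P HP] := Levz g.
rewrite !(@fsum_trunc _ _ _ (M + P)%N) => [|k le|k le|k le].
- by rewrite scaler_sumr -big_split; apply: eq_bigr => k _; rewrite Llin.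
- by apply: HP; lia.
- by apply: HM; lia.
- by rewrite Llin HM ?HP ?scaler0 ?addr0 //; lia.
Qed.

Lemma sum_linear (K : pzRingType) (V W : lmodType K) (J : Type) (s : seq J)
    (P : pred J) (L : J -> V -> W) :
  (forall k, linear (L k)) -> linear (fun f => \sum_(k <- s | P k) L k f).
Proof.
move=> Llin a f g; rewrite scaler_sumr -big_split.
by apply: eq_bigr => k _; rewrite Llin.
Qed.

Lemma scale_linear (K : comPzRingType) (V W : lmodType K) (b : K) (L : V -> W) :
  linear L -> linear (fun f => b *: L f).
Proof. by move=> Llin a f g; rewrite Llin scalerDr !scalerA mulrC. Qed.

Lemma add_linear (K : pzRingType) (V W : lmodType K) (L L' : V -> W) :
  linear L -> linear L' -> linear (fun f => L f + L' f).
Proof. by move=> Ll Ll' a f g; rewrite Ll Ll' scalerDr addrACA. Qed.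

(* Here [x k] and [d k] stand for T_k and its derivation; keeping the algebra
   abstract stops unification from unfolding the monoid algebra. *)
Section Virasoro.
Context {R : realType}.

(** Integer indices are allowed because [k + m] is -1 for [k = 0] in L_{-1}. *)
Definition dz {V : comAlgType R[i]} (d : nat -> {linear V -> V}) (k : int) (f : V) : V :=
  if k is Posz n then d n f else 0.

Section Definitions.
Context {V : comAlgType R[i]} (x : nat -> V) (d : nat -> {linear V -> V}).

Definition vir1 (m : int) (f : V) : V :=
  \sum_(i < `|m|.+1) \sum_(j < `|m|.+1 | i%:Z + j%:Z == - m - 1)
    (@dfact R (2 * i%:Z - 1) * @dfact R (2 * j%:Z - 1))^-1 *: (x i * (x j * f)).

Definition vcoef (m : int) (k : nat) : R[i] :=
  @dfact R (2 * k%:Z + 2 * m + 1) / @dfact R (2 * k%:Z - 1).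

Definition vir2 (m : int) (f : V) : V :=
  \sum_(k \in [set: nat]) vcoef m k *: (x k * dz d (k%:Z + m) f).

Definition vir3 (m : int) (f : V) : V :=
  \sum_(i < `|m|.+1) \sum_(j < `|m|.+1 | i%:Z + j%:Z == m - 1)
    (@dfact R (2 * i%:Z + 1) * @dfact R (2 * j%:Z + 1)) *: d i (d j f).

Definition vir (m : int) (f : V) : V :=
  2%:R^-1 *: vir1 m f + vir2 m f + 2%:R^-1 *: vir3 m f.

End Definitions.

Section Theory.
Context {V : comAlgType R[i]} (x : nat -> V) (d : nat -> {linear V -> V}).
Hypothesis d_evz : forall f, evz (fun k => d k f).

Lemma dz_linear k : linear (dz d k).
Proof. by case: k => n a f g /=; [rewrite linearP|rewrite scaler0 addr0]. Qed.

Lemma dz_evz m f : evz (fun k : nat => dz d (k%:Z + m) f).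
Proof.
have [M HM] := d_evz f; exists (M + `|m|)%N => k le.
have -> : k%:Z + m = (absz (k%:Z + m))%:Z by lia.
by apply: HM; lia.
Qed.

Lemma vir2_evz m f : evz (fun k : nat => vcoef m k *: (x k * dz d (k%:Z + m) f)).
Proof.
have [M HM] := dz_evz m f; exists M => k /HM ->.
by rewrite mulr0 scaler0.
Qed.

Lemma vir_linear m : linear (vir x d m).
Proof.
apply: add_linear; [apply: add_linear; [apply: scale_linear|]|apply: scale_linear].
- apply: sum_linear => i; apply: sum_linear => j; apply: scale_linear => a f g.
  by rewrite !mulrDr !scalerAr.
- apply: fsum_linear => [k|f]; last exact: vir2_evz.
  by apply: scale_linear => a f g; rewrite dz_linear mulrDr scalerAr.
- apply: sum_linear => i; apply: sum_linear => j; apply: scale_linear => a f g.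
  by rewrite !linearP.
Qed.

(* Conjugation by exp D shifts T_k by [t k]; the term T_0^2 of L_{-1} is
   unaffected because [t 0 = 0]. *)
Lemma vir_comm (D : {linear V -> V}) (t : nat -> R[i]) m f : -1 <= m -> t 0%N = 0 ->
  (forall k g, D (x k * g) = x k * D g + t k *: g) ->
  (forall k g, D (d k g) = d k (D g)) ->
  D (vir x d m f) = vir x d m (D f) +
    \sum_(k \in [set: nat]) (vcoef m k * t k) *: dz d (k%:Z + m) f.
Proof.
move=> m1 t0 Dx Dd.
have Ddz k g : D (dz d k g) = dz d k (D g) by case: k => n /=; rewrite ?Dd ?raddf0.
have e1 : D (vir1 x m f) = vir1 x m (D f).
  rewrite /vir1 raddf_sum; apply: eq_bigr => i _; rewrite raddf_sum; apply: eq_bigr => j ij.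
  (* As [m >= -1], the condition [i + j = - m - 1] leaves only the term T_0^2. *)
  have i0 : i = 0%N :> nat by lia.
  have j0 : j = 0%N :> nat by lia.
  by rewrite [LHS]linearZ_LR /= !Dx i0 j0 t0 !scale0r !addr0.
have e3 : D (vir3 d m f) = vir3 d m (D f).
  rewrite /vir3 raddf_sum; apply: eq_bigr => i _; rewrite raddf_sum; apply: eq_bigr => j ij.
  by rewrite [LHS]linearZ_LR /= !Dd.
have e2 : D (vir2 x d m f) = vir2 x d m (D f) +
    \sum_(k \in [set: nat]) (vcoef m k * t k) *: dz d (k%:Z + m) f.
  rewrite /vir2 (fsum_morph _ (raddfD D) (raddf0 D) (vir2_evz m f)).
  rewrite -fsumD; [|exact: vir2_evz|].
    by apply: eq_fsbigr => k _; rewrite [LHS]linearZ_LR /= Dx Ddz scalerDr scalerA.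
  by have [M HM] := dz_evz m f; exists M => k /HM ->; rewrite scaler0.
by rewrite /vir !linearD !linearZ_LR /= e1 e2 e3 !addrA [LHS]addrAC.
Qed.

(** The factor [g] is constant for the derivations of the family. It will be the product of the
    tau-functions of the other families. *)
Lemma vir_mulr m f g : (forall k h, d k (h * g) = d k h * g) ->
  vir x d m (f * g) = vir x d m f * g.
Proof.
move=> dg; have dzg k h : dz d k (h * g) = dz d k h * g.
  by case: k => n /=; rewrite ?dg ?mul0r.
rewrite /vir !mulrDl -!scalerAl; congr (_ *: _ + _ + _ *: _).
- rewrite mulr_suml; apply: eq_bigr => i _; rewrite mulr_suml; apply: eq_bigr => j _.
  by rewrite -scalerAl !mulrA.
- rewrite /vir2 (fsum_morph (phi := fun h => h * g) _ _ _ (vir2_evz m f)) ?mul0r //.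
    by apply: eq_fsbigr => k _; rewrite dzg -scalerAl mulrA.
  by move=> u v; rewrite mulrDl.
- rewrite mulr_suml; apply: eq_bigr => i _; rewrite mulr_suml; apply: eq_bigr => j _.
  by rewrite !dg -scalerAl.
Qed.

(** An intertwiner of variables and derivations intertwines every expression in them; the intended
    [phi] renames T_k to T^a_k. *)
Lemma vir_morph (W : comAlgType R[i]) (y : nat -> W) (e : nat -> {linear W -> W})
    (phi : V -> W) m f : linear phi ->
  (forall k g, phi (x k * g) = y k * phi g) ->
  (forall k g, phi (d k g) = e k (phi g)) ->
  phi (vir x d m f) = vir y e m (phi f).
Proof.
move=> lin phix phid; have phiD := linD lin; have phiZ := linZ lin.
have phi0 := lin0 lin.
have phidz k g : phi (dz d k g) = dz e k (phi g).
  by case: k => n /=; rewrite ?phid ?phi0.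
rewrite /vir !phiD !phiZ; congr (_ *: _ + _ + _ *: _).
- rewrite (lin_sum lin); apply: eq_bigr => i _; rewrite (lin_sum lin).
  by apply: eq_bigr => j _; rewrite phiZ !phix.
- rewrite /vir2 (fsum_morph _ phiD phi0 (vir2_evz m f)).
  by apply: eq_fsbigr => k _; rewrite phiZ phix phidz.
- rewrite (lin_sum lin); apply: eq_bigr => i _; rewrite (lin_sum lin).
  by apply: eq_bigr => j _; rewrite phiZ !phid.
Qed.

End Theory.
End Virasoro.

(** * Conjugation by the exponential of D / hbar *)

Section Conjugation.
Context {K : numFieldType} {V : lmodType K} (D : {linear V -> V}).

(** The coefficient of hbar^d in exp(D / hbar) F: each factor 1 / hbar reads one degree higher. *)
Definition shift_exp (F : int -> V) (d : int) : V :=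
  \sum_(n \in [set: nat]) (n`!%:R^-1 : K) *: iter n D (F (d + n%:Z)).

Context (l0 l1 c : V -> V) (F : int -> V).
Hypotheses (l0_lin : linear l0) (l1_lin : linear l1) (c_lin : linear c).
Hypothesis Dl0 : forall f, D (l0 f) = l0 (D f) + c f.
Hypothesis Dl1 : forall f, D (l1 f) = l1 (D f).
Hypothesis Dc : forall f, D (c f) = c (D f).
Hypothesis F_evz : forall d, evz (fun n => iter n D (F (d + n%:Z))).

(** The commutator [c] of [D] and [l0] commutes with [D], so it is collected [n] times. At [n = 0]
    the truncated predecessor is harmless, its coefficient being 0. *)
Lemma iter_l0 n f : iter n D (l0 f) = l0 (iter n D f) + n%:R *: c (iter n.-1 D f).
Proof.
elim: n => [|n IH]; first by rewrite scale0r addr0.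
rewrite iterS IH (linD (linearP D)) Dl0 (linZ (linearP D)) Dc.
case: n {IH} => [|n] /=; first by rewrite !scale0r addr0 scale1r.
by rewrite -addrA -{1}[c _]scale1r -scalerDl -[1]/(1%:R) -natrD.
Qed.

Lemma iter_l1 n f : iter n D (l1 f) = l1 (iter n D f).
Proof. by elim: n => //= n ->; rewrite Dl1. Qed.

(** Conjugation fixes l1 and turns l0 into l0 + c / hbar; the iterated commutators stop there. *)
Lemma exp_conj d : (forall d, l0 (F d) + l1 (F (d + 1)) = 0) ->
  l0 (shift_exp F d) + l1 (shift_exp F (d + 1)) + c (shift_exp F (d + 1)) = 0.
Proof.
move=> F0; have [M HM] := F_evz d; have [P HP] := F_evz (d + 1).
pose N := (M + P)%N.
have expE e N' : (forall n, (N' <= n)%N -> iter n D (F (e + n%:Z)) = 0) ->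
    shift_exp F e = \sum_(n < N') (n`!%:R^-1 : K) *: iter n D (F (e + n%:Z)).
  move=> H; rewrite /shift_exp (@fsum_trunc _ _ _ N') => [|n le].
    by apply: eq_bigl => n; rewrite in_setT.
  by rewrite H ?scaler0.
have e0 : shift_exp F d = \sum_(n < N.+1) (n`!%:R^-1 : K) *: iter n D (F (d + n%:Z)).
  by apply: expE => n le; apply: HM; lia.
have e1 : shift_exp F (d + 1) =
    \sum_(n < N.+1) (n`!%:R^-1 : K) *: iter n D (F (d + 1 + n%:Z)).
  by apply: expE => n le; apply: HP; lia.
(* The same coefficient, cut one term earlier to match the index shift [n.+1] in the final
   comparison. *)
have e2 : shift_exp F (d + 1) =
    \sum_(n < N) (n`!%:R^-1 : K) *: iter n D (F (d + 1 + n%:Z)).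
  by apply: expE => n le; apply: HP; lia.
(* Applying D^n to the equation of [F] in degree [d + n] leaves only the commutator terms of
   [iter_l0]; afterwards n / n! becomes 1 / (n-1)!. *)
have -> : l0 (shift_exp F d) + l1 (shift_exp F (d + 1)) =
    - \sum_(n < N.+1) (n`!%:R^-1 * n%:R : K) *: c (iter n.-1 D (F (d + n%:Z))).
  rewrite e0 e1 (lin_sum l0_lin) (lin_sum l1_lin) -big_split -sumrN.
  apply: eq_bigr => n _ /=; rewrite (linZ l0_lin) (linZ l1_lin) -scalerDr -scalerA.
  rewrite -scalerN; congr (_ *: _); apply/eqP; rewrite -subr_eq0 opprK addrAC -iter_l0.
  by rewrite -iter_l1 -iter_raddfD addrAC F0 iter_raddf0.
rewrite big_ord_recl mulr0 scale0r add0r addrC e2 (lin_sum c_lin).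
apply/eqP; rewrite subr_eq0; apply/eqP; apply: eq_bigr => n _.
rewrite (linZ c_lin) lift0.
have -> : d + n.+1%:Z = d + 1 + n%:Z by lia.
by congr (_ *: _); rewrite factS natrM invfM mulrAC mulVf ?mul1r // pnatr_eq0.
Qed.

End Conjugation.

(** * Operators on Laurent series, read coefficientwise *)

Section Laurent.
Context {R : realType} {I : choiceType}.
Implicit Types (F : @hlaurent R I) (v : nat -> I).

Definition TA : comAlgType R[i] := @Tpoly R I.
Definition pdv v : nat -> {linear TA -> TA} := fun n => @pder R I (v n).
Definition Tv v : nat -> TA := fun n => @Tvar R I (v n).

Lemma dTE i F d : dT i F d = pder i (F d).
Proof. by rewrite pder.unlock. Qed.

Lemma dTzE v k F d : dTz v k F d = dz (pdv v) k (F d).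
Proof. by case: k => n //=; exact: dTE. Qed.

(** With variables for the series, the conversion check meets only pointwise operations. *)
Let evalE (a b : R[i]) (f g h : @hlaurent R I) d :
  (a *: f + g + b *: h) d = a *: (f d : TA) + (g d : TA) + b *: (h d : TA) := erefl.

Lemma virasoroE v m F d : virasoro v m F d = vir (Tv v) (pdv v) m (F d).
Proof.
rewrite /virasoro /vir.
set A := (X in _ *: X + _ + _).
set B := (X in _ *: _ + X + _).
set C := (X in (_ + _ *: X) d = _).
have e1 : A d = vir1 (Tv v) m (F d).
  rewrite /vir1 /A fct_sumE; apply: eq_bigr => i _.
  by rewrite fct_sumE; apply: eq_bigr.
have e2 : B d = vir2 (Tv v) (pdv v) m (F d).
  by rewrite /vir2 /B /hsum; apply: eq_fsbigr => k _; rewrite -dTzE.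
have e3 : C d = vir3 (pdv v) m (F d).
  rewrite /vir3 /C fct_sumE; apply: eq_bigr => i _.
  rewrite fct_sumE; apply: eq_bigr => j _.
  by rewrite /pdv /= -(dTE (v j) F d) -(dTE (v i) (dT (v j) F) d).
by rewrite -e1 -e2 -e3; exact: evalE.
Qed.

End Laurent.

(** * Several families of variables *)

Section Families.
Context {R : realType} {N : nat} {V : comAlgType R[i]}.
Context (x : 'I_N * nat -> V) (d : 'I_N * nat -> {linear V -> V}).
Hypothesis dC : forall i j f, d i (d j f) = d j (d i f).
Hypothesis dx : forall i j f, d i (x j * f) = x j * d i f + (i == j)%:R *: f.
Hypothesis d_fin : forall f, exists M : nat, forall a k, (M <= k)%N -> d (a, k) f = 0.

Lemma family_evz a f : evz (fun k => d (a, k) f).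
Proof. by have [M HM] := d_fin f; exists M => k /HM. Qed.

Definition transl (t : 'I_N -> nat -> R[i]) (f : V) : V :=
  \sum_(k \in [set k : nat | (1 <= k)%N]) \sum_(a < N) t a k *: d (a, k) f.

Lemma transl_evz t f : evz (fun k => \sum_(a < N) t a k *: d (a, k) f).
Proof.
have [M HM] := d_fin f; exists M => k /HM d0.
by rewrite big1 // => a _; rewrite d0 scaler0.
Qed.

Lemma transl_linear t : linear (transl t).
Proof.
apply: fsum_linear => [k|f]; last exact: transl_evz.
by apply: sum_linear => a; apply: scale_linear => b f g; rewrite linearP.
Qed.

(** Only the derivation along T^a_k itself meets the variable, and the translation has no component
    at [k = 0]. *)
Lemma transl_x t a k f : transl t (x (a, k) * f) =
  x (a, k) * transl t f + (if (1 <= k)%N then t a k else 0) *: f.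
Proof.
transitivity (\sum_(j \in [set j : nat | (1 <= j)%N])
   (x (a, k) * (\sum_(b < N) t b j *: d (b, j) f) + (if j == k then t a k else 0) *: f)).
  apply: eq_fsbigr => j _; rewrite mulr_sumr.
  transitivity (\sum_(b < N) (x (a, k) * (t b j *: d (b, j) f)
      + (t b j * ((b, j) == (a, k))%:R) *: f)).
    by apply: eq_bigr => b _; rewrite dx scalerDr scalerA scalerAr.
  rewrite big_split /= -scaler_suml; congr (_ + _ *: _).
  rewrite (bigD1 a) //= big1 => [|b ba].
    by rewrite xpair_eqE eqxx addr0; case: eqP => [->|_]; rewrite ?mulr1 ?mulr0.
  by rewrite xpair_eqE (negbTE ba) mulr0.
rewrite fsumD; first last.
- by exists k.+1 => j lt; rewrite gtn_eqF // scale0r.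
- by have [M HM] := transl_evz t f; exists M => j /HM ->; rewrite mulr0.
congr (_ + _).
  rewrite /transl (fsum_morph (phi := fun g => x (a, k) * g) _ _ _ (transl_evz t f)) ?mulr0 //.
  by move=> g h; rewrite mulrDr.
case: ltnP => [k1|k0].
  rewrite (fsbigE [:: k]) //=.
  - by rewrite big_cons big_nil addr0 mem_set // eqxx.
  - by move=> j /=; rewrite inE => /eqP ->.
  - by move=> j _; rewrite inE => /negbTE ->; rewrite scale0r.
rewrite scale0r; apply: fsbig1 => j /= j1.
by rewrite gtn_eqF ?scale0r //; lia.
Qed.

Lemma transl_d t i f : transl t (d i f) = d i (transl t f).
Proof.
rewrite /transl (fsum_morph _ (linD (linearP (d i))) (lin0 (linearP (d i))) (transl_evz t f)).
apply: eq_fsbigr => k _; rewrite (lin_sum (linearP (d i))).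
by apply: eq_bigr => a _; rewrite (linZ (linearP (d i))) dC.
Qed.

Definition rgen (r : nat -> 'M[R[i]]_N) (f : V) : V :=
  \sum_(k \in [set k : nat | (1 <= k)%N]) \sum_(a < N) \sum_(b < N)
    (\sum_(j \in [set: nat]) r k b a *: (x (a, j) * d (b, (k + j)%N) f)
     + 2%:R^-1 *: \sum_(j < k)
         ((-1) ^+ j.+1 * r k b a) *: d (a, j : nat) (d (b, (k - j - 1)%N) f)).

Lemma rgen_linear r : linear (rgen r).
Proof.
apply: fsum_linear => [k|f].
  apply: sum_linear => a; apply: sum_linear => b; apply: add_linear.
    apply: fsum_linear => [j|f].
      by apply: scale_linear => e f g; rewrite linearP mulrDr scalerAr.
    have [M HM] := d_fin f; exists M => j le.
    by rewrite HM ?mulr0 ?scaler0 //; lia.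
  apply: scale_linear; apply: sum_linear => j; apply: scale_linear => e f g.
  by rewrite !linearP.
(* For [k >= 2 M], at least one of the indices [j] and [k - j - 1] of a second-order term is at
   least [M]. *)
have [M HM] := d_fin f; exists (M + M)%N => k le.
rewrite big1 // => a _; rewrite big1 // => b _.
rewrite fsbig1 => [|j _]; last by rewrite HM ?mulr0 ?scaler0 //; lia.
rewrite add0r big1 ?scaler0 // => j _; have [le'|lt] := leqP M j.
  by rewrite dC [d (a, _) f]HM // raddf0 scaler0.
by rewrite [d (b, _) f]HM ?raddf0 ?scaler0 //; lia.
Qed.

Context (a : 'I_N) (al : bool) (s : R[i]) (t : 'I_N -> nat -> R[i]) (m : int).
Local Notation xa := (fun k => x (a, k)).
Local Notation da := (fun k => d (a, k)).

(** The Virasoro operator Lambda is lam0 + (lam1 + lam2) / hbar: lam0 is free of hbar, lam1 is the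
    dilaton term, and lam2 carries the coefficients of the translation. *)
Definition lam0 (f : V) : V :=
  2%:R^-1 *: vir xa da m f + ((m == 0)%:R / 16%:R) *: f.

Definition lam1 (f : V) : V :=
  - ((@dfact R (2 * m + 2 * (al : nat)%:Z + 1) / (2%:R * s)) *: dz da (m + (al : nat)%:Z) f).

Definition lam2 (f : V) : V :=
  2%:R^-1 *: \sum_(k \in [set k : nat | (1 + al <= k)%N])
     (vcoef m k * t a k) *: dz da (m + k%:Z) f.

Hypothesis m_ge : - (al : nat)%:Z <= m.
Hypothesis t1 : al -> t a 1 = 0.

Lemma lam0_linear : linear lam0.
Proof.
apply: add_linear; apply: scale_linear => //.
exact/vir_linear/family_evz.
Qed.

Lemma lam1_linear : linear lam1.
Proof.
move=> b f g; rewrite /lam1 (dz_linear da) !scalerDr opprD scalerN !scalerA.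
by rewrite [b * _]mulrC.
Qed.

Lemma lam2_evz f : evz (fun k => (vcoef m k * t a k) *: dz da (m + k%:Z) f).
Proof.
have [M HM] := dz_evz (family_evz a) m f; exists M => k /HM.
by rewrite addrC => ->; rewrite scaler0.
Qed.

Lemma lam2_linear : linear lam2.
Proof.
apply: scale_linear; apply: fsum_linear => [k|f]; last exact: lam2_evz.
exact/scale_linear/dz_linear.
Qed.

Lemma transl_dz k f : transl t (dz da k f) = dz da k (transl t f).
Proof. by case: k => n /=; rewrite ?transl_d // (lin0 (transl_linear t)). Qed.

Let D : {linear V -> V} := HB.pack (transl t)
  (GRing.isLinear.Build R[i] V V *:%R (transl t) (transl_linear t)).

(** The deformation term of Lambda is exactly the commutator of the translation with the undeformed
    operator. *)
Lemma transl_lam0 f : transl t (lam0 f) = lam0 (transl t f) + lam2 f.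
Proof.
have vc := @vir_comm R V xa da (family_evz a) D
  (fun k => if (1 <= k)%N then t a k else 0) m f.
have tl := transl_linear t.
rewrite /lam0 (linD tl) !(linZ tl) [transl t (vir _ _ _ _)]vc //; first last.
- by move=> k g; apply: transl_d.
- by move=> k g; apply: transl_x.
- by case: (al) m_ge; lia.
rewrite scalerDr addrAC; congr (_ + _ + _ *: _).
rewrite [RHS]fsbig_mkcond; apply: eq_fsbigr => k _; rewrite /patch addrC.
have -> : (k \in [set k : nat | (1 + al <= k)%N]%classic) = (1 + al <= k)%N.
  by apply/idP/idP => [/set_mem|/mem_set].
case: ltnP => [k0|k0]; last by rewrite mulr0 scale0r; case: ifP => // kal; lia.
(* The commutator runs over [k >= 1] and lam2 over [k >= 1 + al]. They differ only at [k = 1] for a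
   regular point, where the translation coefficient vanishes. *)
case: ifP => // /negbT; rewrite -leqNgt => kal.
have [al1 k1] : al /\ k = 1%N by case: (al) kal; lia.
by rewrite k1 t1 // mulr0 scale0r.
Qed.

Lemma exp_lam (F : int -> V) (e : int) :
  (forall e, evz (fun n => iter n (transl t) (F (e + n%:Z)))) ->
  (forall e, lam0 (F e) + lam1 (F (e + 1)) = 0) ->
  let E := fun e => \sum_(n \in [set: nat])
     (n`!%:R^-1 : R[i]) *: iter n (transl t) (F (e + n%:Z)) in
  lam0 (E e) + lam1 (E (e + 1)) + lam2 (E (e + 1)) = 0.
Proof.
move=> F_evz F0; apply: (@exp_conj _ V D lam0 lam1 lam2 F) => //.
- exact: lam0_linear.
- exact: lam1_linear.
- exact: lam2_linear.
- exact: transl_lam0.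
- move=> f; have tl := transl_linear t.
  by rewrite /lam1 -scaleN1r [D _](linZ tl) (linZ tl) [transl _ _]transl_dz scaleN1r.
- move=> f; have tl := transl_linear t; rewrite /lam2 [D _](linZ tl).
  congr (_ *: _).
  rewrite (fsum_morph _ (linD tl) (lin0 tl) (lam2_evz f)); apply: eq_fsbigr => k _.
  by rewrite (linZ tl) transl_dz.
Qed.
End Families.

(** * Renaming T_k to T^a_k *)

Section Renaming.
Context {R : realType} {N : nat} (a : 'I_N).
Local Notation idx := ('I_N * nat)%type.
Implicit Types (f g : @Tpoly R nat) (m : cmonom nat).

Lemma scale_malgU (I : choiceType) (c e : R[i]) (u : cmonom I) :
  mkmalgU u (c * e) = c *: mkmalgU u e :> @Tpoly R I.
Proof.
transitivity (mkmalgU (onecm I) c * mkmalgU u e : @Tpoly R I).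
  by rewrite malgMUU mul0cm.
exact: mul_malgC.
Qed.

Lemma malgU1 (I : choiceType) : mkmalgU (onecm I) 1 = 1 :> @Tpoly R I.
Proof. by rewrite -mpolyC1E. Qed.

Definition fam_mon m : cmonom idx :=
  \big[@mulcm idx/onecm idx]_(k <- finsupp m)
    iter (m k) (mulcm (ucm (a, k))) (onecm idx).

Lemma iter_mulcmE (I : choiceType) n (u : cmonom I) i :
  iter n (mulcm u) (onecm I) i = (n * u i)%N.
Proof. by elim: n => [|n IH]; rewrite ?onecmE ?mul0n // iterS mulcmE IH mulSn. Qed.

Lemma fam_monE m b k : fam_mon m (b, k) = if b == a then m k else 0%N.
Proof.
rewrite /fam_mon (big_morph (fun u : cmonom idx => u (b, k)) (op1 := addn) (id1 := 0%N));
  [|by move=> u v; rewrite mulcmE|by rewrite onecmE].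
under eq_bigr => j _ do rewrite iter_mulcmE ucmE xpair_eqE eq_sym.
case: eqP => [_|_]; last by rewrite big1 // => j _; rewrite muln0.
case: (finsuppP m k) => [kN|kS].
  rewrite big1_fset // => j jS _; case: eqP => [e|_]; last by rewrite muln0.
  by rewrite -e jS in kN.
rewrite (big_fsetD1 k) //= eqxx muln1 big1_fset ?addn0 // => j.
by rewrite in_fsetD1 => /andP[/negbTE -> _] _; rewrite muln0.
Qed.

Lemma fam_monM k m : fam_mon (mulcm (ucm k) m) = mulcm (ucm (a, k)) (fam_mon m).
Proof.
apply/eqP/cmP => -[b j]; rewrite mulcmE !fam_monE mulcmE !ucmE xpair_eqE eq_sym.
by case: eqP.
Qed.

Lemma fam_mon_div m k : fam_mon (divcm m (ucm k)) = divcm (fam_mon m) (ucm (a, k)).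
Proof.
apply/eqP/cmP => -[b j]; rewrite divcmE !fam_monE divcmE !ucmE xpair_eqE eq_sym.
by case: eqP.
Qed.

(** The factor [c] lets each family rescale its weights, so that families of both types get a common
    weight for hbar. *)
Lemma wt_fam_mon (w : idx -> nat) (w0 : nat -> nat) (c : nat) m :
  (forall k, w (a, k) = (c * w0 k)%N) -> wt w (fam_mon m) = (c * wt w0 m)%N.
Proof.
move=> wE; rewrite /fam_mon (big_morph _ (wtM w) (wt1 w)) [in RHS]/wt big_distrr /=.
apply: eq_bigr => k _; rewrite mulnA -wE mulnC.
elim: (m k) => [|n IH]; first exact: wt1.
by rewrite iterS wtM IH wtU mulSn.
Qed.

Lemma prod_Tvar m :
  \prod_(k <- finsupp m) Tvar (a, k) ^+ m k = mkmalgU (fam_mon m) 1 :> @Tpoly R idx.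
Proof.
have mU : {morph (fun u => mkmalgU u 1 : @Tpoly R idx) : u v / mulcm u v >-> u * v}.
  by move=> u v; rewrite malgMUU mulr1.
rewrite /fam_mon (big_morph _ mU (malgU1 _)); apply: eq_bigr => k _.
elim: (m k) => [|n IH]; first by rewrite expr0 malgU1.
by rewrite exprS IH iterS mU.
Qed.

(** Any larger index set will do, so polynomials with different supports can be summed over one
    set. *)
Lemma in_familyEw (e : {fset cmonom nat}) f : (msupp f `<=` e)%fset ->
  in_family a f = \sum_(m <- e) mkmalgU (fam_mon m) (mcoeff m f).
Proof.
move=> le; rewrite /in_family (big_fset_incl _ le) /=.
  by apply: eq_bigr => m _; rewrite prod_Tvar -scale_malgU mulr1.
by move=> m _ /mcoeff_outdom ->; rewrite scale0r.
Qed.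

Lemma in_familyU m (c : R[i]) : in_family a (mkmalgU m c) = mkmalgU (fam_mon m) c.
Proof. by rewrite (in_familyEw (msuppU_le)) big_seq_fset1 mcoeffUU. Qed.

Lemma in_family_linear : linear (@in_family R N a).
Proof.
move=> c f g; pose e := (msupp f `|` msupp g)%fset.
rewrite (@in_familyEw e (c *: f + g)); last first.
  apply: fsubset_trans (msuppD_le _ _) _.
  by apply: fsetSU; apply: msuppZ_le.
rewrite (@in_familyEw e f) ?fsubsetUl // (@in_familyEw e g) ?fsubsetUr //.
rewrite scaler_sumr -big_split; apply: eq_bigr => m _ /=.
by rewrite mcoeffD mcoeffZ monalgUD scale_malgU.
Qed.

Lemma in_family_Tvar k f : in_family a (Tvar k * f) = Tvar (a, k) * in_family a f.
Proof.
have L := in_family_linear.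
rewrite [f]monalgE mulr_sumr !(lin_sum L) mulr_sumr; apply: eq_bigr => m _.
by rewrite !in_familyU /Tvar !malgMUU in_familyU fam_monM.
Qed.

Lemma pder_in_family b k f :
  pder (b, k) (in_family a f) = if b == a then in_family a (pder k f) else 0.
Proof.
have L := in_family_linear.
transitivity (\sum_(m <- msupp f)
    if b == a then in_family a (pder k (mkmalgU m (mcoeff m f))) else 0).
  rewrite {1}[f]monalgE (lin_sum L) raddf_sum; apply: eq_bigr => m _.
  rewrite in_familyU [LHS]pderU fam_monE; case: eqP => [->|_].
    by rewrite pderU in_familyU fam_mon_div.
  by rewrite mulr0n [LHS]monalgU0.
case: eqP => _; last by rewrite big1.
by rewrite [in RHS](monalgE f) raddf_sum (lin_sum L).
Qed.

Lemma wle_in_family (w : idx -> nat) (w0 : nat -> nat) (c : nat) e f :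
  (forall k, w (a, k) = (c * w0 k)%N) -> wle w0 e f ->
  wle w (c%:Z * e) (in_family a f).
Proof.
move=> wE /wleP H; rewrite (in_familyEw (fsubset_refl _)) big_seq.
apply: wle_sum => m /H le; apply/wleP => u /(fsubsetP msuppU_le).
by rewrite in_fset1 => /eqP ->; rewrite (wt_fam_mon _ wE) PoszM ler_wpM2l.
Qed.

End Renaming.

(** * Weights of the tau-functions *)

Lemma scale_solve (K : fieldType) (V : lmodType K) (b : K) (P Q U : V) :
  b != 0 -> Q - b *: P + U = 0 -> P = b^-1 *: (Q + U).
Proof.
move=> b0 /eqP; rewrite addrAC subr_eq0 => /eqP ->.
by rewrite scalerA mulVf // scale1r.
Qed.

Section Tau.
Context {R : realType}.
Local Notation w0 := (fun k : nat => 2 * k + 1)%N.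

Lemma dfact_neq0 n : @dfact R n != 0.
Proof.
case: n => n; rewrite /dfact ?oner_eq0 // pnatr_eq0 -lt0n.
by apply: prodn_cond_gt0 => i; case: (i : nat).
Qed.

Lemma wle_dz k c f : wle w0 c f -> wle w0 (c - (2 * k + 1)) (dz (pdv id) k f : @Tpoly R nat).
Proof.
case: k => n H /=; last exact: wle0.
by apply: wle_mono (wle_pder n H); lia.
Qed.

(** With T_k of weight 2 k + 1, each of the three sums in L_m is homogeneous of degree - 2 m. *)
Lemma wle_vir m c (f : @Tpoly R nat) : wle w0 c f ->
  wle w0 (c - 2 * m) (vir (Tv id) (pdv id) m f).
Proof.
move=> H; apply: wleD; [apply: wleD; [apply: wleZ|]|apply: wleZ].
- apply: wle_sum => i _; apply: wle_sum => j /eqP ij; apply: wleZ.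
  by apply: wle_mono (wle_TvarM (i : nat) (wle_TvarM (j : nat) H)); lia.
- apply: wle_fsum => k _; apply: wleZ.
  by apply: wle_mono (wle_TvarM k (wle_dz (k%:Z + m) H)); lia.
- apply: wle_sum => i _; apply: wle_sum => j /eqP ij; apply: wleZ.
  by apply: wle_mono (wle_pder (i : nat) (wle_pder (j : nat) H)); lia.
Qed.

Context (al : bool) (tau : @hseries R nat).
Hypothesis tau_tau : is_tau al tau.
Local Notation L := (to_laurent tau).

Lemma tau_virasoro (k d : int) : - (al : nat)%:Z <= k ->
  2%:R^-1 *: vir (Tv id) (pdv id) k (L d)
  - (@dfact R (2 * k + 2 * (al : nat)%:Z + 1) / 2%:R)
      *: dz (pdv id) (k + (al : nat)%:Z) (L (d + 1))
  + ((k == 0)%:R / 16%:R) *: (L d : @TA R nat) = 0.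
Proof.
move=> /(proj2 tau_tau) /(congr1 (fun F : @hlaurent R nat => F d)).
by rewrite -virasoroE -dTzE.
Qed.

Lemma pder_tau_wle (j : nat) c (d : int) : wle w0 c (L d) ->
  wle w0 (c + 2 * (al : nat)%:Z + 1 - (2 * j + 1)%N%:Z) (pder j (L (d + 1))).
Proof.
(* This is the index whose dilaton term differentiates along T_j; its coefficient is nonzero, so the
   equation can be solved for that derivative. *)
move=> H; pose k := j%:Z - (al : nat)%:Z.
have k_ge : - (al : nat)%:Z <= k by rewrite /k; lia.
have kj : k + (al : nat)%:Z = j by rewrite /k; lia.
have := @tau_virasoro k d k_ge; rewrite kj /=.
set b : R[i] := @dfact R _ / _; set P : @TA R nat := pder j _.
set Q := 2%:R^-1 *: _; set U := _ *: (L d : @TA R nat) => e.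
have b0 : b != 0 by rewrite mulf_neq0 ?dfact_neq0 // invr_eq0 pnatr_eq0.
rewrite (scale_solve b0 e).
apply: wleZ; apply: wleD.
  by apply: wleZ; apply: wle_mono (wle_vir k H); lia.
rewrite /U; case: (eqVneq k 0) => [k0|_]; last by rewrite mul0r scale0r wle0.
by apply: wleZ; apply: wle_mono H; lia.
Qed.

Lemma tau_wle n : wle w0 ((2 * (al : nat)%:Z + 1) * n%:Z) (tau n).
Proof.
elim: n => [|n IH].
  apply: pder_wle => [|j]; first by rewrite mulr0.
  (* The coefficient in degree -1 is 0 and satisfies any bound; this one yields the bound required
     of the derivatives of [tau 0]. *)
  have /(@pder_tau_wle j _ (-1)) : wle w0 (- (2 * (al : nat)%:Z + 1)) (L (-1)) by exact: wle0.
  by apply: wle_mono; lia.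
apply: pder_wle => [|j]; first by apply: mulr_ge0; lia.
have -> : tau n.+1 = L (n%:Z + 1) by rewrite -addn1.
by apply: wle_mono (@pder_tau_wle j _ n IH); lia.
Qed.

End Tau.

(** * The Givental operators *)

Section Products.
Context {K : comPzRingType} {V : comAlgType K} (l0 l1 : V -> V).
Hypotheses (l0_lin : linear l0) (l1_lin : linear l1).

(* The equation [(l0 + l1 / hbar) F = 0], coefficientwise in hbar. *)
Definition killed (F : nat -> V) :=
  l1 (F 0%N) = 0 /\ forall n, l0 (F n) + l1 (F n.+1) = 0.

Definition cprod (F P : nat -> V) (n : nat) : V := \sum_(i < n.+1) F i * P (n - i)%N.

Lemma cprodC F P n : cprod F P n = cprod P F n.
Proof.
rewrite /cprod (reindex_inj rev_ord_inj); apply: eq_bigr => i _ /=.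
by rewrite mulrC !subSS subKn // -ltnS.
Qed.

(** Both operators treat the coefficients of [P] as constants. The l1-sum has one term more, which
    is the lowest equation of [F] times a coefficient of [P]. *)
Lemma killed_cprod F P : killed F ->
  (forall f j, l0 (f * P j) = l0 f * P j) ->
  (forall f j, l1 (f * P j) = l1 f * P j) -> killed (cprod F P).
Proof.
move=> [F0 F1] l0P l1P; split=> [|n].
  by rewrite /cprod big_ord1 l1P F0 mul0r.
rewrite /cprod (lin_sum l0_lin) (lin_sum l1_lin) [X in _ + X]big_ord_recl.
rewrite l1P F0 mul0r add0r -big_split big1 // => i _ /=.
by rewrite l0P l1P /bump !add1n subSS -mulrDl F1 mul0r.
Qed.

End Products.

(** Replacing hbar by s hbar multiplies the degree n coefficient by s^n, which explains the factor 1
    / s in the dilaton term. *)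
Lemma scale_shift (K : fieldType) (V : lmodType K) (s b u : K) n (v p f : V) :
  s != 0 -> 2%:R^-1 *: v - (b / 2%:R) *: p + u *: f = 0 ->
  s ^+ n *: (2%:R^-1 *: v + u *: f) + s ^+ n.+1 *: - ((b / (2%:R * s)) *: p) = 0.
Proof.
move=> s0 e; rewrite exprSr -scalerA -scalerDr scalerN scalerA.
have -> : s * (b / (2%:R * s)) = b / 2%:R.
  by rewrite invfM mulrC -!mulrA mulVf // mulr1.
by rewrite addrAC e scaler0.
Qed.

Lemma natr_mulE (K : pzRingType) (V : lalgType K) (n : nat) (f : V) :
  n%:R * f = n%:R *: f.
Proof. by rewrite mulr_natl scaler_nat. Qed.

(** * Specialisation to the polynomial ring; invertibility of R *)

Section Instance.
Context {R : realType} {N : nat}.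
Local Notation idx := ('I_N * nat)%type.
Local Notation T := (@TA R idx).

Definition X : idx -> T := fun i => @Tvar R idx i.
Definition dX : idx -> {linear T -> T} := fun i => @pder R idx i.

Lemma dX_comm i j f : dX i (dX j f) = dX j (dX i f).
Proof. exact: pderC. Qed.

Lemma pder_TvarM (I : choiceType) (i j : I) (f : @Tpoly R I) :
  pder i (Tvar j * f) = Tvar j * pder i f + (i == j)%:R *: f.
Proof.
apply: (etrans (pderM i (Tvar j) f)); apply: (etrans (addrC _ _)).
by rewrite [pder i (Tvar j)]pder_Tvar natr_mulE.
Qed.

Lemma dX_X i j f : dX i (X j * f) = X j * dX i f + (i == j)%:R *: f.
Proof. exact: pder_TvarM. Qed.

Lemma dX_fin f : exists M : nat, forall a k, (M <= k)%N -> dX (a, k) f = 0.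
Proof.
(* Giving T^a_k the weight [k] bounds the indices of the variables that occur in [f]. *)
have [c H] := wle_ex (fun i : idx => i.2) f; exists c.+1 => a k lt.
by apply: wle_pder0 H; rewrite ltz_nat.
Qed.

Context (G : givental_data R N).

Lemma That_gen (F : @hlaurent R idx) n e :
  iter n (fun F => hinv (hsum [set k : nat | (1 <= k)%N]%classic (fun k =>
    \sum_(a < N) gT G a k *: dT (a, k) F))) F e =
  iter n (transl dX (gT G)) (F (e + n%:Z)).
Proof.
elim: n e => [|n IH] e; first by rewrite addr0.
rewrite !iterS /hinv /hsum /transl; apply: eq_fsbigr => k _.
rewrite fct_sumE; apply: eq_bigr => a _.
have -> : e + n.+1%:Z = (e + 1) + n%:Z by lia.
by rewrite -IH /dX /= -dTE.
Qed.

Lemma Rgen_E (F : @hlaurent R idx) e : Rgen G F e = rgen X dX (gr G) (F e).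
Proof.
rewrite /Rgen /hsum /rgen; apply: eq_fsbigr => k _.
rewrite fct_sumE; apply: eq_bigr => a _.
rewrite fct_sumE; apply: eq_bigr => b _.
set U := (X in (_ + _ *: X) e = _).
have -> : \sum_(j < k) ((-1) ^+ j.+1 * gr G k b a) *:
    dX (a, j : nat) (dX (b, (k - j - 1)%N) (F e)) = U e.
  rewrite /U fct_sumE; apply: eq_bigr => j _.
  by rewrite /dX /= -dTE -dTE.
have e1 : \sum_(j \in [set: nat]) gr G k b a *: (X (a, j) * dX (b, (k + j)%N) (F e)) =
    hsum setT (fun j => gr G k b a *: mulT (a, j) (dT (b, (k + j)%N) F)) e.
  by rewrite /hsum; apply: eq_fsbigr => j _; rewrite /dX /= -dTE.
exact: (congr1 (fun z : T => z + 2%:R^-1 *: (U e : T)) (esym e1)).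
Qed.

Definition rL : {linear T -> T} := HB.pack (rgen X dX (gr G))
  (GRing.isLinear.Build R[i] T T *:%R (rgen X dX (gr G))
     (rgen_linear X dX_comm dX_fin (gr G))).

(** First-order terms lower the weight by [k] and second-order terms by [k + 1], where [k >= 1]. *)
Lemma wle_rL c (f : T) : wle (fun i : idx => i.2.+1) c f ->
  wle (fun i : idx => i.2.+1) (c - 1) (rL f : @Tpoly R idx).
Proof.
move=> H; apply: wle_fsum => k /= k1; apply: wle_sum => a _; apply: wle_sum => b _.
apply: wleD; [apply: wle_fsum => j _; apply: wleZ|apply: wleZ; apply: wle_sum => j _; apply: wleZ].
  by apply: wle_mono (wle_TvarM (a, j) (wle_pder (b, (k + j)%N) H)) => /=; lia.
by apply: wle_mono (wle_pder (a, j : nat) (wle_pder (b, (k - j - 1)%N) H)) => /=; lia.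
Qed.

Lemma rL_nilpotent f : exists n, iter n rL f = 0.
Proof.
have [c H] := wle_ex (fun i : idx => i.2.+1) f; exists c.+1.
suff Hn n : wle (fun i : idx => i.2.+1) (c%:Z - n%:Z) (iter n rL f : @Tpoly R idx).
  by apply: (wle_lt0 _ (Hn c.+1)); lia.
elim: n => [|n IH]; first by rewrite subr0.
by apply: wle_mono (wle_rL IH); lia.
Qed.

Lemma RhatE F e : Rhat G F e = exp_op rL (F e).
Proof.
rewrite /Rhat /op_exp /exp_op; apply: eq_fsbigr => n _; congr (_ *: _).
by elim: n => //= n IH; rewrite Rgen_E IH.
Qed.

Lemma Rhat_invE F e : Rhat_inv G F e =
  \sum_(n \in [set: nat]) (n`!%:R^-1 : R[i]) *: iter n (fun f => - rL f) (F e).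
Proof.
rewrite /Rhat_inv /op_exp; apply: eq_fsbigr => n _; congr (_ *: _).
elim: n => //= n <-.
exact: (congr1 (fun z : T => - z) (Rgen_E _ e)).
Qed.

Lemma Rhat_invK F : Rhat_inv G (Rhat G F) = F.
Proof.
apply/funext => e; rewrite Rhat_invE RhatE.
by have [n] := rL_nilpotent (F e); apply: exp_inv.
Qed.

Lemma Rhat0 : Rhat G 0 = 0.
Proof.
apply/funext => e; rewrite RhatE; apply: fsbig1 => n _.
by rewrite iter_raddf0 scaler0.
Qed.

Section OneFamily.
Context (al : 'I_N -> bool) (a : 'I_N) (m : int).
Local Notation l0 := (lam0 X dX a m).
Local Notation l1 := (lam1 dX a (al a) (gsqrtDelta G a) m).
Local Notation l2 := (lam2 dX a (al a) (gT G) m).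

Lemma Lambda_hatE (F : @hlaurent R idx) e :
  Lambda_hat G al a m F e = l0 (F e) + l1 (F (e + 1)) + l2 (F (e + 1)).
Proof.
pose v k : idx := (a, k).
have e1 : virasoro v m F e = vir (fun k => X (a, k)) (fun k => dX (a, k)) m (F e).
  exact: virasoroE.
have e2 : dTz v (m + (al a : nat)%:Z) F (e + 1) =
    dz (fun k => dX (a, k)) (m + (al a : nat)%:Z) (F (e + 1)).
  exact: dTzE.
have e3 : hsum [set k : nat | (1 + al a <= k)%N]%classic (fun k =>
    (dfact (2 * m + 2 * k%:Z + 1) / dfact (2 * k%:Z - 1) * gT G a k)
        *: dTz v (m + k%:Z) F) (e + 1) =
    \sum_(k \in [set k : nat | (1 + al a <= k)%N]%classic)
     (vcoef m k * gT G a k) *: dz (fun k => dX (a, k)) (m + k%:Z) (F (e + 1)).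
  apply: eq_fsbigr => k _; rewrite /vcoef [2 * k%:Z + 2 * m]addrC.
  exact: (congr1 (fun z : T => _ *: z) (dTzE v _ F (e + 1))).
rewrite /l0 /l1 /l2 -e1 -e2 -e3.
(* The rearrangement is proved in an abstract group, away from the polynomial structure. *)
have algE (V : zmodType) (p q r u : V) : p - q + r + u = p + u + - q + r.
  by rewrite addrAC [p - q + u]addrAC.
exact: (algE T).
Qed.

End OneFamily.
End Instance.

Section FamilyProducts.
Context {R : realType} {N : nat} {V : comAlgType R[i]}.
Context (x : 'I_N * nat -> V) (d : 'I_N * nat -> {linear V -> V}).
Hypothesis d_fin : forall f, exists M : nat, forall a k, (M <= k)%N -> d (a, k) f = 0.
Context (a : 'I_N) (g : V).
Hypothesis dg : forall k h, d (a, k) (h * g) = d (a, k) h * g.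

Lemma lam0_mulr m f : lam0 x d a m (f * g) = lam0 x d a m f * g.
Proof.
rewrite /lam0 (vir_mulr _ (family_evz d_fin a) _ _ dg).
by rewrite [RHS]mulrDl -!scalerAl.
Qed.

Lemma lam1_mulr al s m f : lam1 d a al s m (f * g) = lam1 d a al s m f * g.
Proof.
rewrite /lam1 mulNr -scalerAl; congr (- (_ *: _)).
by case: (_ + _) => n /=; rewrite ?mul0r ?dg.
Qed.

End FamilyProducts.

Lemma lin_eq3 (K : pzRingType) (V W : lmodType K) (phi : V -> W) (a b c : K) (p q r : V) :
  linear phi -> a *: p - b *: q + c *: r = 0 ->
  a *: phi p - b *: phi q + c *: phi r = 0.
Proof.
move=> L e; rewrite -!(linZ L) -(linB L) -(linD L) e.
exact: lin0 L.
Qed.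

Lemma pder1 (R : realType) (I : choiceType) (i : I) : pder i 1 = 0 :> @Tpoly R I.
Proof. by rewrite -malgU1 [LHS]pderU onecmE mulr0n monalgU0. Qed.

(** * The product of tau-functions and its translation *)

Section DeltaHat.
Context {R : realType} {N : nat} (G : givental_data R N).
Context (al : 'I_N -> bool) (tau : bool -> @hseries R nat).
Hypothesis tau_tau : forall b, is_tau b (tau b).
Hypothesis s_neq0 : forall b, gsqrtDelta G b != 0.
Hypothesis gT1 : forall b, al b -> gT G b 1 = 0.
Local Notation idx := ('I_N * nat)%type.
Local Notation T := (@TA R idx).

(* Normalised so that hbar has weight 3 for both kinds of tau-functions. *)
Definition dil_wt (i : idx) : nat := ((if al i.1 then 1 else 3) * (2 * i.2 + 1))%N.

Definition tau_fam (b : 'I_N) : nat -> T :=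
  fun n => gsqrtDelta G b ^+ n *: (in_family b (tau (al b) n) : T).

(** A list of families instead of all of them allows induction over the factors. *)
Definition prod_fam (r : seq 'I_N) : @hseries R idx :=
  \big[@hmul R idx/@hone R idx]_(b <- r) tau_fam b.

Lemma prod_fam_cons b r n : prod_fam (b :: r) n = cprod (tau_fam b) (prod_fam r : nat -> T) n.
Proof. by rewrite /prod_fam big_cons. Qed.

Lemma tau_fam_wle b n : wle dil_wt (3 * n%:Z) (tau_fam b n : @Tpoly R idx).
Proof.
apply: wleZ; have := tau_wle (tau_tau (al b)) n.
move/(@wle_in_family R N b dil_wt _ (if al b then 1 else 3) _ _ (fun k => erefl)).
by apply: wle_mono; case: (al b); lia.
Qed.

Lemma prod_fam_wle r n : wle dil_wt (3 * n%:Z) (prod_fam r n).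
Proof.
elim: r n => [|b r IH] n.
  rewrite /prod_fam big_nil /hone; case: n => [|n]; first exact: wle1.
  exact: wle0.
rewrite prod_fam_cons; apply: wle_sum => i _.
by apply: wle_mono (wleM (tau_fam_wle b i) (IH (n - i)%N)); have := ltn_ord i; lia.
Qed.

Lemma dX_mulr (a : 'I_N) (f h : T) k : dX (a, k) f = 0 ->
  dX (a, k) (h * f) = dX (a, k) h * f.
Proof.
move=> f0; apply: (etrans (pderM _ _ _)).
by rewrite [X in _ + _ * X]f0 mulr0 addr0.
Qed.

Lemma tau_fam_free a b n k : b != a -> dX (a, k) (tau_fam b n) = 0.
Proof.
move=> ba; rewrite /tau_fam (linZ (linearP (dX (a, k)))).
by rewrite [dX _ _]pder_in_family eq_sym (negbTE ba) scaler0.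
Qed.

Lemma prod_fam_free a r n k : a \notin r -> dX (a, k) (prod_fam r n) = 0.
Proof.
elim: r n => [|b r IH] n.
  rewrite /prod_fam big_nil /hone => _; case: n => [|n]; first exact: pder1.
  exact: lin0 (linearP (dX (a, k))).
rewrite in_cons negb_or prod_fam_cons => /andP[ab ar].
rewrite /cprod (lin_sum (linearP (dX (a, k)))) big1 // => i _.
by rewrite dX_mulr ?IH // tau_fam_free ?mul0r // eq_sym.
Qed.

Lemma tau_fam_killed a m : - (al a : nat)%:Z <= m ->
  killed (lam0 X dX a m) (lam1 dX a (al a) (gsqrtDelta G a) m) (tau_fam a).
Proof.
move=> m_ge; pose L := in_family_linear (R := R) a.
have virE f : (in_family a (vir (Tv id) (pdv id) m f : @Tpoly R nat) : T) =
    vir (fun k => X (a, k)) (fun k => dX (a, k)) m (in_family a f).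
  apply: (@vir_morph R (@TA R nat) (Tv id) (pdv id) _ T _ _ (in_family a) m f).
  - move=> g; have [c H] := wle_ex id g; exists c.+1 => k lt.
    by apply: wle_pder0 H; rewrite ltz_nat.
  - exact: L.
  - by move=> k g; apply: in_family_Tvar.
  - by move=> k g; rewrite [RHS]pder_in_family eqxx.
have dzE k f : (in_family a (dz (pdv id) k f : @Tpoly R nat) : T) =
    dz (fun k => dX (a, k)) k (in_family a f).
  case: k => k /=; last exact: lin0 L.
  by rewrite [RHS]pder_in_family eqxx.
have eqE e := @lin_eq3 R[i] (@TA R nat) T (in_family a) _ _ _ _ _ _ L
  (tau_virasoro (tau_tau (al a)) e m_ge).
split=> [|n].
  (* In degree -1 only the dilaton derivative of the constant coefficient remains, and it must
     vanish. *)
  have := eqE (-1); rewrite virE dzE /=; set z := dz _ _ _.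
  have L0 : (in_family a 0 : T) = 0 := lin0 L.
  rewrite L0 (lin0 (vir_linear _ (family_evz (@dX_fin R N) a) m)) => e.
  have z0 : z = 0.
    rewrite (scale_solve _ e) ?scaler0 ?addr0 ?scaler0 //.
    by rewrite mulf_neq0 ?dfact_neq0 // invr_eq0 pnatr_eq0.
  by rewrite /tau_fam /lam1 expr0 scale1r -/z z0 scaler0 oppr0.
have := eqE n%:Z; rewrite virE dzE => e.
have tS : to_laurent (tau (al a)) (n%:Z + 1) = tau (al a) n.+1 by rewrite /= addn1.
rewrite tS in e; rewrite /tau_fam (linZ (lam0_linear _ dX_fin _ _)) (linZ (lam1_linear _ _ _ _ _)).
exact: (scale_shift n (s_neq0 a) e).
Qed.

(** Exactly one factor involves the variables T^a, as [r] has no repetition; the other factors pass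
    through the operators as constants. *)
Lemma prod_fam_killed a m r : - (al a : nat)%:Z <= m -> uniq r -> a \in r ->
  killed (lam0 X dX a m) (lam1 dX a (al a) (gsqrtDelta G a) m) (prod_fam r : nat -> T).
Proof.
move=> m_ge; have L0 := @lam0_linear R N T X dX dX_fin a m.
have L1 := lam1_linear dX a (al a) (gsqrtDelta G a) m.
elim: r => // b r IH /= /andP[br ur]; rewrite in_cons.
have -> : prod_fam (b :: r) = cprod (tau_fam b) (prod_fam r : nat -> T).
  by apply/funext => n; apply: prod_fam_cons.
have [e _|ab /= ar] := eqVneq a b.
  have free j k h : dX (a, k) (h * (prod_fam r j : T)) = dX (a, k) h * prod_fam r j.
    by apply/dX_mulr/prod_fam_free; rewrite e.
  have kb : killed (lam0 X dX a m) (lam1 dX a (al a) (gsqrtDelta G a) m) (tau_fam b).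
    by rewrite -e; exact: tau_fam_killed.
  apply: (killed_cprod L0 L1 kb) => f j.
    by apply: (lam0_mulr X (@dX_fin R N) (free j)).
  by apply: (lam1_mulr (free j)).
have -> : cprod (tau_fam b) (prod_fam r : nat -> T) = cprod (prod_fam r : nat -> T) (tau_fam b).
  by apply/funext => n; apply: cprodC.
have free j k h : dX (a, k) (h * tau_fam b j) = dX (a, k) h * tau_fam b j.
  by apply/dX_mulr/tau_fam_free; rewrite eq_sym.
apply: (killed_cprod L0 L1 (IH ur ar)) => f j.
  by apply: (lam0_mulr X (@dX_fin R N) (free j)).
by apply: (lam1_mulr (free j)).
Qed.

Lemma transl_wle c (f : T) : wle dil_wt c f ->
  wle dil_wt (c - 5) (transl dX (gT G) f : @Tpoly R idx).
Proof.
move=> H; apply: wle_fsum => k /= k1; apply: wle_sum => b _.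
(* The least weight in the translation is 5, from T_2 in a regular family; an irregular one starts
   at 9 with T_1. The regular T_1, of weight 3, has coefficient 0. *)
have [/andP[alb /eqP ->]|bk] := boolP (al b && (k == 1%N)).
  by rewrite gT1 // scale0r wle0.
apply: wleZ; apply: wle_mono (wle_pder (b, k) H).
by rewrite /dil_wt /=; case: (al b) bk => /=; lia.
Qed.

Lemma transl_evz_prod r e : evz (fun n =>
  iter n (transl dX (gT G)) (to_laurent (prod_fam r) (e + n%:Z) : T)).
Proof.
(* After n steps the weight is at most 3 (e + n) - 5 n = 3 e - 2 n, which is negative from here
   on. *)
exists (2 * `|e|).+1 => n le.
have Hn j e' : wle dil_wt (3 * e' - 5 * j%:Z)
    (iter j (transl dX (gT G)) (to_laurent (prod_fam r) e' : T) : @Tpoly R idx).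
  elim: j => [|j IH].
    case: e' => e' /=; last exact: wle0.
    by apply: wle_mono (prod_fam_wle r e'); lia.
  by apply: wle_mono (transl_wle IH); lia.
by apply: (wle_lt0 _ (Hn n (e + n%:Z))); lia.
Qed.

Lemma Lambda_That a m : - (al a : nat)%:Z <= m ->
  Lambda_hat G al a m (That G (to_laurent (Delta_hat G al tau))) = 0.
Proof.
move=> m_ge; apply/funext => e; rewrite Lambda_hatE.
have ThatE F e' : That G F e' = \sum_(n \in [set: nat])
    (n`!%:R^-1 : R[i]) *: iter n (transl dX (gT G)) (F (e' + n%:Z) : T).
  rewrite /That /op_exp; apply: eq_fsbigr => n _.
  exact: (congr1 (fun z : T => _ *: z) (That_gen G F n e')).
rewrite !ThatE; pose P := prod_fam (index_enum 'I_N).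
apply: (@exp_lam R N T X dX dX_comm dX_X dX_fin a (al a) (gsqrtDelta G a) (gT G) m m_ge
  (@gT1 a) (fun e => to_laurent P e : T)) => [e'|e'].
  exact: transl_evz_prod.
have [K0 K1] := prod_fam_killed m_ge (index_enum_uniq _) (mem_index_enum a).
have L0 := lin0 (@lam0_linear R N T X dX dX_fin a m).
have L1 := lin0 (lam1_linear dX a (al a) (gsqrtDelta G a) m).
(* Degree -1 gives the separate equation for the constant coefficient; below it every term is 0. *)
case: e' => [n|[|n]].
- by have := K1 n; rewrite /= addn1.
- by have := K0; rewrite /= L0 add0r.
- have -> : Negz n.+1 + 1 = Negz n by lia.
  by rewrite /= L0 L1 addr0.
Qed.

End DeltaHat.

(** * Undoing the conjugation by R *)

Theorem corollary6p1 (R : realType) (N : nat) (S : tr_data R N)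
    (tau : bool -> @hseries R nat) (Z : @hseries R ('I_N * nat)%type)
    (G : givental_data R N) :
  (forall al : bool, is_tau al (tau al)) ->
  is_partition_function S Z ->
  is_givental_data S tau Z G ->
  forall (a : 'I_N) (m : int), - (alpha S a)%:Z <= m ->
    L_hat G (regular S) a m (to_laurent Z) = 0.
Proof.
move=> tau_tau _ [gT1 DeltaE sqrtE ZE] a m m_ge.
(* The index 2 alpha - 1 selects y_1 at a regular point and y_{-1} at an irregular one, and this
   coefficient is nonzero by the type of the point. *)
have s_neq0 b : gsqrtDelta G b != 0.
  have : gDelta G b != 0.
    rewrite DeltaE invr_eq0 expf_eq0 /=; have := y_type S b; rewrite /alpha.
    by case: (regular S b) => // -[_].
  by rewrite -sqrtE sqrf_eq0.
by rewrite /L_hat ZE Rhat_invK Lambda_That ?Rhat0.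
Qed.
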